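(* (1) The $\mathbb Q(v^{1/2})$-algebra homomorphism $\widetilde\Omega:\widetilde{\mathcal H}(Q,\varrho)\to\widetilde{\mathcal H}(Q^{\mathrm{dbl}},\mathrm{swap})$ induces (by restriction) a $\mathcal Z$-algebra homomorphism $\widetilde\Omega:\widetilde{\mathcal H}(Q,\varrho)_{\mathcal Z}\to\widetilde{\mathcal H}(Q^{\mathrm{dbl}},\mathrm{swap})_{\mathcal Z}$. (2) The $\mathbb Q(v^{1/2})$-algebra homomorphism $\widetilde\Delta:\widetilde{\mathcal H}(Q,\varrho)\to\widetilde{\mathcal H}(Q,\varrho)\otimes\widetilde{\mathcal H}(Q^{\mathrm{dbl}},\mathrm{swap})$ induces (by restriction) a $\mathcal Z$-algebra homomorphism $\widetilde\Delta:\widetilde{\mathcal H}(Q,\varrho)_{\mathcal Z}\to\widetilde{\mathcal H}(Q,\varrho)_{\mathcal Z}\otimes\widetilde{\mathcal H}(Q^{\mathrm{dbl}},\mathrm{swap})_{\mathcal Z}$.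
   Context: Setting. $Q$ is a Dynkin quiver (underlying graph a simply-laced Dynkin diagram, type ADE) with vertex set $\mathbb I=\{1,\dots,n\}$, and $\varrho$ is an involution of $Q$, i.e. a quiver automorphism with $\varrho^2=\mathrm{Id}$ (possibly $\varrho=\mathrm{Id}$). $\Phi^+$ is the set of positive roots, inside the root lattice $\mathbb Z^{\mathbb I}=\bigoplus_i\mathbb Z\alpha_i$; $\varrho$ acts on both; $\Phi^+_0=\{\beta\in\Phi^+\mid\varrho\beta=\beta\}$, $\Phi^+_1=\Phi^+\setminus\Phi^+_0$, $\mathbb I_0=\{i\in\mathbb I\mid\varrho i=i\}$. The Euler form is $\langle x,y\rangle_Q=\sum_i x_iy_i-\sum_{(i\to j)\in Q_1}x_iy_j$, and $(x,y)_Q=\langle x,y\rangle_Q+\langle y,x\rangle_Q$. For a finite field $\mathbb F_q$ and $\beta\in\Phi^+$, $M_q(\beta)$ is the indecomposable representation of $Q$ over $\mathbb F_q$ of dimension vector $\beta$. $\mathfrak P$ is the set of functions $\lambda:\Phi^+\to\mathbb N$; $M_q(\lambda)=\bigoplus_\beta M_q(\beta)^{\oplus\lambda(\beta)}$, with dimension vector $d^\lambda=(d^\lambda_i)_i$; $(\varrho\lambda)(\beta)=\lambda(\varrho\beta)$. For $\alpha\in\mathbb Z^{\mathbb I}$ write $\alpha=(d^\alpha_i)_i$. An element $\lambda\in\mathfrak P$ appearing in a bilinear form, in a sum with elements of $\mathbb Z^{\mathbb I}$, or in a subscript of $\mathbb K$ stands for $d^\lambda$. Hall polynomials. For modules $X,Y,Z$,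 $F_{XZ}^Y$ is the number of submodules $L\subseteq Y$ with $L\cong Z$, $Y/L\cong X$; $G_{XZ}^Y=|\mathrm{Ext}^1(X,Z)_Y|/|\mathrm{Hom}(X,Z)|$, where $\mathrm{Ext}^1(X,Z)_Y$ is the set of extension classes with middle term isomorphic to $Y$; $a_X=|\mathrm{Aut}(X)|$. There are $f_{\lambda,\mu}^{\nu}(v),g_{\lambda,\mu}^{\nu}(v),a_\lambda(v)\in\mathbb Z[v,v^{-1}]$ whose values at $v=\sqrt q$ are $F_{M_q(\lambda),M_q(\mu)}^{M_q(\nu)}$, $G_{M_q(\lambda),M_q(\mu)}^{M_q(\nu)}$, $a_{M_q(\lambda)}$ for every $q$; $a_\lambda(v^2)$ is obtained by substituting $v\mapsto v^2$. Iterated version: $f^\lambda_{\lambda_1,\dots,\lambda_m}=\sum_\mu f^\lambda_{\lambda_1,\mu}f^\mu_{\lambda_2,\dots,\lambda_m}$. The set $\mathcal F$. $\mathcal F=\{\lambda\in\mathfrak P\mid\varrho(\lambda)=\lambda,\ 2\mid\lambda(\beta)\ \forall\beta\in\Phi^+_0\}$. For $\lambda\in\mathcal F$, $\lambda_f(\beta)=\lambda(\beta)/2$ if $\beta\in\Phi^+_0$ and $0$ otherwise; $\lambda_c(\beta)=\lambda(\beta)$ if $\beta\in\Phi^+_1$ and $0$ otherwise. $b_{\lambda_c}(v)\in\mathbb Z[v,v^{-1}]$ is the square root of $a_{\lambda_c}(v)$ (it exists) with positive leading coefficient. $\{\lambda,\mu\}=\dim\mathrm{Hom}(M_q(\lambda),M_q(\mu))+\dim\mathrm{Hom}(M_q(\mu),M_q(\lambda))$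 (independent of $q$). Generic iHall algebra. $\widetilde{\mathcal H}(Q,\varrho)$ (generic version of the twisted semi-derived Ringel–Hall algebra of the iquiver algebra of $(Q,\varrho)$; the definition also applies to disjoint unions of ADE Dynkin quivers) is the associative unital $\mathbb Q(v^{1/2})$-algebra with basis $\{\mathbb K_\alpha*\mathfrak u_\lambda\mid\alpha\in\mathbb Z^{\mathbb I},\lambda\in\mathfrak P\}$ and multiplication determined by $\mathbb K_0=\mathfrak u_0=1$, $\mathbb K_\alpha*\mathbb K_\beta=\mathbb K_{\alpha+\beta}$, $\mathbb K_\alpha*\mathfrak u_\lambda=v^{(\varrho\alpha,\lambda)_Q-(\alpha,\lambda)_Q}\mathfrak u_\lambda*\mathbb K_\alpha$, and $$\mathfrak u_\lambda*\mathfrak u_\mu=\sum_{\theta,\nu,\gamma,\delta\in\mathfrak P}v^{\langle\delta,\theta\rangle_Q-\langle\varrho\delta,\theta\rangle_Q-\langle\lambda,\mu\rangle_Q+2\langle\nu,\gamma\rangle_Q}a_\delta(v)f^\lambda_{\delta,\nu}(v)f^\mu_{\gamma,\varrho\delta}(v)g^\theta_{\nu,\gamma}(v)\,\mathbb K_\delta*\mathfrak u_\theta.$$ Diagonal type. $Q^{\mathrm{dbl}}=Q\sqcup Q^\diamond$, where $Q^\diamond$ is a copy of $Q$ with vertices $i^\diamond$, and $\mathrm{swap}$ exchanges $i$ and $i^\diamond$. For $\lambda,\mu\in\mathfrak P=\mathfrak P(Q)$, $\mathfrak u_\lambda\oplus\mathfrak u_{\mu^\diamond}\in\widetilde{\mathcal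 H}(Q^{\mathrm{dbl}},\mathrm{swap})$ is the basis element corresponding to $M_q(\lambda)\oplus M_q(\mu)^\diamond$; for $\alpha,\beta\in\mathbb Z^{\mathbb I}$, $\mathbb K_\alpha$ and $\mathbb K_{\beta^\diamond}$ are the elements attached to the root lattices of $Q$ and $Q^\diamond$. Integral forms. $\mathcal Z=\mathbb Z[v^{1/2},v^{-1/2}]$. $\widetilde{\mathcal H}(Q,\varrho)_{\mathcal Z}$ is the $\mathcal Z$-span of $\{\mathbb K_\alpha*\mathfrak u_\lambda\mid\alpha\in\mathbb Z^{\mathbb I},\lambda\in\mathfrak P\}$; it is a $\mathcal Z$-subalgebra. $\widetilde{\mathcal H}(Q^{\mathrm{dbl}},\mathrm{swap})_{\mathcal Z}$ is defined in the same way for $(Q^{\mathrm{dbl}},\mathrm{swap})$. Tensor products of integral forms are over $\mathcal Z$. The homomorphisms. $\widetilde\Omega$ is the algebra homomorphism with $\widetilde\Omega(\mathbb K_\alpha)=v^{\sum_{i\in\mathbb I_0}d_i^\alpha}\mathbb K_{\varrho\alpha}*\mathbb K_{\alpha^\diamond}$ and $$\widetilde\Omega(\mathfrak u_\lambda)=\sum_{\lambda_1,\lambda_2\in\mathfrak P,\ \nu\in\mathcal F}v^{\Xi}f^\lambda_{\lambda_1,\nu,\lambda_2}(v)\frac{a_{2\nu_f}(v)}{a_{\nu_f}(v^2)}b_{\nu_c}(v)\,(\mathfrak u_{\varrho\lambda_2}\oplus\mathfrak u_{\lambda_1^\diamond})*\mathbb K_{\nu+\lambda_2},$$ $\Xi=\langle\lambda_1-\varrho\lambda_2,\nu+\lambda_2\rangle_Q+\sum_{i\in\mathbb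 I_0}d_i^{\lambda_2}+\frac12\sum_{i\in\mathbb I_0}d_i^\nu+2\{\nu_f,\nu_c\}$. $\widetilde\Delta$ is the algebra homomorphism with $\widetilde\Delta(\mathbb K_\alpha)=\mathbb K_\alpha\otimes(\mathbb K_{\varrho\alpha}*\mathbb K_{\alpha^\diamond})$ and $$\widetilde\Delta(\mathfrak u_\lambda)=\sum_{\lambda_1,\lambda_2,\lambda_3,\nu\in\mathfrak P}v^{\Xi'}f^\lambda_{\lambda_1,\nu,\lambda_2,\varrho\nu,\lambda_3}(v)a_\nu(v)(\mathfrak u_{\lambda_2}*\mathbb K_{\varrho\lambda_3+\nu})\otimes\big((\mathfrak u_{\varrho\lambda_3}\oplus\mathfrak u_{\lambda_1^\diamond})*\mathbb K_{\lambda_2+\lambda_3+\nu+\varrho\nu}\big),$$ $\Xi'=\langle\lambda_1,\lambda_2+\lambda_3\rangle_Q+\langle\lambda_2,\lambda_3\rangle_Q+\langle\lambda_3,\varrho\lambda_3\rangle_Q-(\lambda_2+\lambda_3,\varrho\lambda_3)_Q+\langle\lambda_1-\lambda_3,\nu+\varrho\nu\rangle_Q-\langle\lambda_2,\nu-\varrho\nu\rangle_Q$. *)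

(* Defs.v *)
From HB Require Import structures.
From mathcomp Require Import all_boot all_order all_algebra fraction all_field.
From mathcomp Require Import mxrepresentation.
From mathcomp Require Import finmap boolp classical_sets fsbigop.

Set Implicit Arguments.
Unset Strict Implicit.
Unset Printing Implicit Defensive.

Import GRing.Theory Num.Def Num.Theory.
Local Open Scope ring_scope.

Record quiver := Quiver {
  vertex : finType;
  arrow : finType;
  src : arrow -> vertex;
  tgt : arrow -> vertex }.

(* The vertices of a diagram of rank n are numbered 0, ..., n-1.  Type A is the
   chain 0 - 1 - ... - (n-1).  In types D and E the first n-1 vertices form a
   chain, and vertex n-1 is attached to vertex n-3 (type D), resp. to vertex 2
   (type E, n = 6, 7, 8). *)
Variant dynkin_type := TypeA of nat | TypeD of nat | TypeE of nat.

Definition dynkin_rank (t : dynkin_type) : nat :=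
  match t with TypeA n | TypeD n | TypeE n => n end.

Definition dynkin_valid (t : dynkin_type) : bool :=
  match t with
  | TypeA n => (0 < n)%N
  | TypeD n => (3 < n)%N
  | TypeE n => (5 < n < 9)%N
  end.

Definition dynkin_edge (t : dynkin_type) (i j : nat) : bool :=
  match t with
  | TypeA n => j == i.+1
  | TypeD n => (j == i.+1) && (j < n.-1)%N || (i == (n - 3)%N) && (j == n.-1)
  | TypeE n => (j == i.+1) && (j < n.-1)%N || (i == 2%N) && (j == n.-1)
  end.

Definition nb_edges (Q : quiver) (x y : vertex Q) : nat :=
  #|[pred a : arrow Q | (src a == x) && (tgt a == y)
                     || (src a == y) && (tgt a == x)]|.

Definition is_dynkin (Q : quiver) : Prop :=
  exists2 t : dynkin_type, dynkin_valid t &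
  exists2 phi : 'I_(dynkin_rank t) -> vertex Q, bijective phi &
    forall i j : 'I_(dynkin_rank t),
      nb_edges (phi i) (phi j) = (dynkin_edge t i j || dynkin_edge t j i).

Record quiver_involution (Q : quiver) := QuiverInvolution {
  rho_v :> vertex Q -> vertex Q;
  rho_a : arrow Q -> arrow Q;
  rho_src : forall a, src (rho_a a) = rho_v (src a);
  rho_tgt : forall a, tgt (rho_a a) = rho_v (tgt a);
  rho_vK : involutive rho_v;
  rho_aK : involutive rho_a }.

Definition quiver_dbl (Q : quiver) : quiver :=
  @Quiver (vertex Q + vertex Q)%type (arrow Q + arrow Q)%type
    (fun a => match a with inl a => inl (src a) | inr a => inr (src a) end)
    (fun a => match a with inl a => inl (tgt a) | inr a => inr (tgt a) end).

Definition sum_swap (T : Type) (x : T + T) : T + T :=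
  match x with inl y => inr y | inr y => inl y end.

Definition swap (Q : quiver) : quiver_involution (quiver_dbl Q).
Proof.
by refine (@QuiverInvolution (quiver_dbl Q) (@sum_swap _) (@sum_swap _)
             _ _ _ _) => -[].
Defined.

Notation lattice Q := {ffun vertex Q -> int}.

Definition euler (Q : quiver) (x y : lattice Q) : int :=
  \sum_i x i * y i - \sum_(a : arrow Q) x (src a) * y (tgt a).

Definition sym_euler (Q : quiver) (x y : lattice Q) : int :=
  euler x y + euler y x.

Definition simple_root (Q : quiver) (i : vertex Q) : lattice Q :=
  [ffun j => (i == j)%:Z].

Definition reflection (Q : quiver) (i : vertex Q) (x : lattice Q) : lattice Q :=
  x - simple_root i *~ sym_euler x (simple_root i).

(* The roots are the images of the simple roots under the Weyl group. *)
Inductive is_root (Q : quiver) : lattice Q -> Prop :=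
| IsRootSimple i : is_root (simple_root i)
| IsRootRefl i x : is_root x -> is_root (reflection i x).

Definition is_posroot (Q : quiver) (x : lattice Q) : bool :=
  `[< is_root x >] && [forall i, 0 <= x i].

Record posroot (Q : quiver) :=
  PosRoot { root_val :> lattice Q; _ : is_posroot root_val }.

HB.instance Definition _ (Q : quiver) := [isSub for @root_val Q].
HB.instance Definition _ (Q : quiver) := [Choice of posroot Q by <:].

(* rho alpha_i = alpha_(rho i), so that (rho x)_i = x_(rho i). *)
Definition lat_act (Q : quiver) (rho : quiver_involution Q) (x : lattice Q) :
  lattice Q := [ffun i => x (rho i)].

Definition lat_inl (Q : quiver) (x : lattice Q) : lattice (quiver_dbl Q) :=
  [ffun i : vertex (quiver_dbl Q) => if i is inl j then x j else 0 : int].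

Definition lat_inr (Q : quiver) (x : lattice Q) : lattice (quiver_dbl Q) :=
  [ffun i : vertex (quiver_dbl Q) => if i is inr j then x j else 0 : int].

Lemma ffun_mulzE (T : finType) (x : {ffun T -> int}) (n : int) (i : T) :
  (x *~ n) i = x i * n.
Proof.
case: n => n; rewrite ?NegzE ?mulrNz ?mulrN ?ffunE -pmulrn ffunMnE.
  by rewrite -mulr_natr natz.
by congr (- _); rewrite -mulr_natr natz.
Qed.

Lemma lat_act_euler Q (rho : quiver_involution Q) (x y : lattice Q) :
  euler (lat_act rho x) (lat_act rho y) = euler x y.
Proof.
rewrite /euler; congr (_ - _).
  rewrite [RHS](reindex_inj (inv_inj (rho_vK rho))).
  by apply: eq_bigr => i _; rewrite !ffunE.
rewrite [RHS](reindex_inj (inv_inj (@rho_aK _ rho))).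
by apply: eq_bigr => a _; rewrite !ffunE rho_src rho_tgt.
Qed.

Lemma lat_act_simple Q (rho : quiver_involution Q) (i : vertex Q) :
  lat_act rho (simple_root i) = simple_root (rho i).
Proof. by apply/ffunP => j; rewrite !ffunE (inv_eq (rho_vK rho)). Qed.

Lemma lat_act_root Q (rho : quiver_involution Q) (x : lattice Q) :
  is_root x -> is_root (lat_act rho x).
Proof.
elim=> [i|i y _ IHy]; first by rewrite lat_act_simple; constructor.
suff -> : lat_act rho (reflection i y) = reflection (rho i) (lat_act rho y).
  by constructor.
rewrite /reflection /sym_euler -lat_act_simple !lat_act_euler.
by apply/ffunP => j; rewrite !ffunE !ffun_mulzE !ffunE.
Qed.

Lemma lat_inl_simple Q (i : vertex Q) :
  lat_inl (simple_root i) = @simple_root (quiver_dbl Q) (inl i).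
Proof. by apply/ffunP => -[j|j]; rewrite !ffunE. Qed.

Lemma lat_inr_simple Q (i : vertex Q) :
  lat_inr (simple_root i) = @simple_root (quiver_dbl Q) (inr i).
Proof. by apply/ffunP => -[j|j]; rewrite !ffunE. Qed.

Lemma lat_inl_euler Q (x y : lattice Q) :
  euler (lat_inl x) (lat_inl y) = euler x y.
Proof.
rewrite /euler !big_sumType /=; congr (_ - _).
  rewrite [X in _ + X]big1 ?addr0 => [|i _]; last by rewrite !ffunE mul0r.
  by apply: eq_bigr => i _; rewrite !ffunE.
rewrite [X in _ + X]big1 ?addr0 => [|i _]; last by rewrite !ffunE mul0r.
by apply: eq_bigr => i _; rewrite !ffunE.
Qed.

Lemma lat_inr_euler Q (x y : lattice Q) :
  euler (lat_inr x) (lat_inr y) = euler x y.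
Proof.
rewrite /euler !big_sumType /=; congr (_ - _).
  rewrite [X in X + _]big1 ?add0r => [|i _]; last by rewrite !ffunE mul0r.
  by apply: eq_bigr => i _; rewrite !ffunE.
rewrite [X in X + _]big1 ?add0r => [|i _]; last by rewrite !ffunE mul0r.
by apply: eq_bigr => i _; rewrite !ffunE.
Qed.

Lemma lat_inl_root Q (x : lattice Q) : is_root x -> is_root (lat_inl x).
Proof.
elim=> [i|i y _ IHy]; first by rewrite lat_inl_simple; constructor.
suff -> : lat_inl (reflection i y) = @reflection (quiver_dbl Q) (inl i) (lat_inl y).
  by constructor.
rewrite /reflection /sym_euler -lat_inl_simple !lat_inl_euler.
by apply/ffunP => -[j|j]; rewrite !(ffunE, ffun_mulzE) ?mul0r ?subr0.
Qed.

Lemma lat_inr_root Q (x : lattice Q) : is_root x -> is_root (lat_inr x).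
Proof.
elim=> [i|i y _ IHy]; first by rewrite lat_inr_simple; constructor.
suff -> : lat_inr (reflection i y) = @reflection (quiver_dbl Q) (inr i) (lat_inr y).
  by constructor.
rewrite /reflection /sym_euler -lat_inr_simple !lat_inr_euler.
by apply/ffunP => -[j|j]; rewrite !(ffunE, ffun_mulzE) ?mul0r ?subr0.
Qed.

Lemma posroot_act_subproof Q (rho : quiver_involution Q) (b : posroot Q) :
  is_posroot (lat_act rho b).
Proof.
case: b => x /= /andP[/asboolP rx /forallP x_ge0]; apply/andP; split.
  by apply/asboolP; apply: lat_act_root.
by apply/forallP => i; rewrite ffunE.
Qed.

Lemma posroot_inl_subproof Q (b : posroot Q) : is_posroot (lat_inl b).
Proof.
case: b => x /= /andP[/asboolP rx /forallP x_ge0]; apply/andP; split.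
  by apply/asboolP; apply: lat_inl_root.
by apply/forallP => -[i|i]; rewrite ffunE.
Qed.

Lemma posroot_inr_subproof Q (b : posroot Q) : is_posroot (lat_inr b).
Proof.
case: b => x /= /andP[/asboolP rx /forallP x_ge0]; apply/andP; split.
  by apply/asboolP; apply: lat_inr_root.
by apply/forallP => -[i|i]; rewrite ffunE.
Qed.

Definition posroot_act Q (rho : quiver_involution Q) (b : posroot Q) : posroot Q :=
  PosRoot (posroot_act_subproof rho b).

Definition posroot_inl Q (b : posroot Q) : posroot (quiver_dbl Q) :=
  PosRoot (posroot_inl_subproof b).

Definition posroot_inr Q (b : posroot Q) : posroot (quiver_dbl Q) :=
  PosRoot (posroot_inr_subproof b).

(* For (disjoint unions of) Dynkin quivers the set of positive roots is finite,
   so that every function on it has finite support. *)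
Notation Pfun Q := {fsfun posroot Q -> nat with 0%N}.

Definition pf_zero (Q : quiver) : Pfun Q := [fsfun].

Definition pf_dim (Q : quiver) (l : Pfun Q) : lattice Q :=
  \sum_(b <- finsupp l) root_val b *+ l b.

Definition pf_act (Q : quiver) (rho : quiver_involution Q) (l : Pfun Q) : Pfun Q :=
  [fsfun b in [fset posroot_act rho c | c in finsupp l]%fset
     => l (posroot_act rho b)].

Definition pf_double (Q : quiver) (l : Pfun Q) : Pfun Q :=
  [fsfun b in finsupp l => (l b).*2].

Definition in_F (Q : quiver) (rho : quiver_involution Q) (l : Pfun Q) : Prop :=
  pf_act rho l = l /\
  forall b : posroot Q, posroot_act rho b = b -> (2 %| l b)%N.

Definition pf_f (Q : quiver) (rho : quiver_involution Q) (l : Pfun Q) : Pfun Q :=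
  [fsfun b in finsupp l => if posroot_act rho b == b then (l b)./2 else 0%N].

Definition pf_c (Q : quiver) (rho : quiver_involution Q) (l : Pfun Q) : Pfun Q :=
  [fsfun b in finsupp l => if posroot_act rho b == b then 0%N else l b].

(* The element of Pfun (quiver_dbl Q) attached to M(l) (+) M(m)^diamond. *)
Definition pf_oplus (Q : quiver) (l m : Pfun Q) : Pfun (quiver_dbl Q) :=
  [fsfun g in ([fset posroot_inl b | b in finsupp l]
               `|` [fset posroot_inr b | b in finsupp m])%fset
     => (\sum_(b <- finsupp l | posroot_inl b == g) l b
         + \sum_(b <- finsupp m | posroot_inr b == g) m b)%N].

(* Vectors are rows: the linear map attached to an arrow a : i -> j is
   x |-> x *m rep_map X a. *)
Record rep (F : finFieldType) (Q : quiver) := Rep {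
  rep_dim : vertex Q -> nat;
  rep_map : forall a : arrow Q, 'M[F]_(rep_dim (src a), rep_dim (tgt a)) }.

Section Representations.
Variables (F : finFieldType) (Q : quiver).
Implicit Types X Y Z : rep F Q.

Definition dimvec X : lattice Q := [ffun i => (rep_dim X i)%:Z].

Definition lin_family X Y : finType :=
  {dffun forall i : vertex Q, 'M[F]_(rep_dim X i, rep_dim Y i)}.

Definition is_hom X Y (h : lin_family X Y) : bool :=
  [forall a : arrow Q, rep_map X a *m h (tgt a) == h (src a) *m rep_map Y a].

Definition is_iso X Y (h : lin_family X Y) : bool :=
  is_hom h && [forall i, row_free (h i) && row_full (h i)].

Definition rep_iso X Y : bool := [exists h : lin_family X Y, is_iso h].

Definition rep0 : rep F Q :=
  @Rep F Q (fun=> 0%N) (fun=> 0).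

Definition rep_sum X Y : rep F Q :=
  @Rep F Q (fun i => rep_dim X i + rep_dim Y i)%N
    (fun a => block_mx (rep_map X a) 0 0 (rep_map Y a)).

Definition rep_zero X : bool := [forall i, rep_dim X i == 0%N].

Definition indecomposable X : Prop :=
  ~~ rep_zero X /\
  forall Y Z, rep_iso X (rep_sum Y Z) -> rep_zero Y || rep_zero Z.

Definition dim_hom X Y (d : nat) : Prop :=
  exists e : 'I_d -> lin_family X Y,
    (forall k, is_hom (e k)) /\
    forall h : lin_family X Y, is_hom h ->
      exists! c : 'rV[F]_d, forall i, h i = \sum_k c 0 k *: e k i.

(* A submodule of Y is a family of row spaces; requiring the matrices L i to be
   the canonical generators <<L i>> makes the encoding injective. *)
Definition is_submod Y (L : lin_family Y Y) : bool :=
  [forall i, <<L i>>%MS == L i]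
  && [forall a : arrow Q, (L (src a) *m rep_map Y a <= L (tgt a))%MS].

Definition subrep Y (L : lin_family Y Y) : rep F Q :=
  @Rep F Q (fun i => \rank (L i))
    (fun a => in_submod (L (tgt a))
                (val_submod (1%:M : 'M_(\rank (L (src a)))) *m rep_map Y a)).

Definition quotrep Y (L : lin_family Y Y) : rep F Q :=
  @Rep F Q (fun i => \rank (cokermx (L i)))
    (fun a => in_factmod (L (tgt a))
                (val_factmod (1%:M : 'M_(\rank (cokermx (L (src a)))))
                   *m rep_map Y a)).

Definition hall_number X Z Y : nat :=
  #|[pred L : lin_family Y Y |
      [&& is_submod L, rep_iso (subrep L) Z & rep_iso (quotrep L) X]]|.

Definition card_hom X Y : nat := #|[pred h : lin_family X Y | is_hom h]|.

Definition card_aut X : nat := #|[pred h : lin_family X X | is_iso h]|.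

(* Short exact sequences 0 -> Z -> Y -> X -> 0 with given middle term Y, and
   their equivalence as extensions of X by Z.  An extension class whose middle
   term is isomorphic to Y is represented by a sequence with middle term Y. *)
Definition is_ses Z Y X (s : lin_family Z Y * lin_family Y X) : bool :=
  [&& is_hom s.1, is_hom s.2 &
   [forall i, [&& row_free (s.1 i), row_full (s.2 i)
                & (s.1 i == kermx (s.2 i))%MS]]].

Definition ext_equiv Z Y X : rel (lin_family Z Y * lin_family Y X) :=
  fun s t => [exists h : lin_family Y Y,
    is_hom h && [forall i, (s.1 i *m h i == t.1 i) && (h i *m t.2 i == s.2 i)]].

Definition card_ext X Z Y : nat :=
  #|equivalence_partition (@ext_equiv Z Y X)
      (finset (fun s => @is_ses Z Y X s))|.

Definition rep_of (M : posroot Q -> rep F Q) (l : Pfun Q) : rep F Q :=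
  \big[rep_sum/rep0]_(b <- finsupp l) iter (l b) (rep_sum (M b)) rep0.

End Representations.

(* Laurent n p represents p / 'X^n. *)
Record laurent := Laurent { lau_ord : nat; lau_num : {poly int} }.

Definition lau_eval (p : laurent) (L : fieldType) (z : L) : L :=
  (map_poly intr (lau_num p)).[z] / z ^+ lau_ord p.

Definition lau_lead (p : laurent) : int := lead_coef (lau_num p).

(* Q(v^(1/2)): rational functions in the indeterminate vh = v^(1/2). *)
Definition Qv : fieldType := {fraction {poly rat}}.
Definition vh : Qv := tofrac ('X : {poly rat}).
Definition v : Qv := vh ^+ 2.

Definition in_Zv : {pred Qv} :=
  fun x => `[< exists p : laurent, x = lau_eval p vh >].

Record Zv := ZvElt { Zv_val :> Qv; _ : Zv_val \in in_Zv }.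

Lemma vh_neq0 : vh != 0.
Proof. by rewrite tofrac_eq0 polyX_eq0. Qed.

Lemma in_Zv_subring_closed : subring_closed in_Zv.
Proof.
split=> [|x y|x y].
- apply/asboolP; exists (Laurent 0 1).
  by rewrite /lau_eval rmorph1 hornerC divr1.
- move=> /asboolP[[n p] ->] /asboolP[[m q] ->]; apply/asboolP.
  exists (Laurent (n + m) (p * 'X^m - q * 'X^n)); rewrite /lau_eval /=.
  rewrite rmorphB !rmorphM /= !map_polyXn hornerD hornerN !hornerM !hornerXn.
  have vn k : vh ^+ k != 0 by rewrite expf_neq0 ?vh_neq0.
  by rewrite exprD -mulNr addf_div // mulNr.
- move=> /asboolP[[n p] ->] /asboolP[[m q] ->]; apply/asboolP.
  exists (Laurent (n + m) (p * q)); rewrite /lau_eval /=.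
  by rewrite rmorphM hornerM exprD mulf_div.
Qed.

HB.instance Definition _ := GRing.isSubringClosed.Build Qv in_Zv in_Zv_subring_closed.
HB.instance Definition _ := [isSub for Zv_val].
HB.instance Definition _ := [Choice of Zv by <:].
HB.instance Definition _ := [SubChoice_isSubComNzRing of Zv by <:].

(* The family hd_M of indecomposable representations is provided by Gabriel's theorem, the
   Hall polynomials by Ringel's theorem.  Two Laurent polynomials taking the same
   values at sqrt q for all prime powers q are equal, so that hd_f, hd_g, hd_a
   are determined by the equations they satisfy. *)
Record hall_data (Q : quiver) := HallData {
  hd_M : forall F : finFieldType, posroot Q -> rep F Q;
  hd_M_indec : forall F b, indecomposable (hd_M F b);
  hd_M_dim : forall F b, dimvec (hd_M F b) = b;
  hd_f : Pfun Q -> Pfun Q -> Pfun Q -> laurent; (* hd_f l m n = f_{l,m}^n *)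
  hd_g : Pfun Q -> Pfun Q -> Pfun Q -> laurent; (* hd_g l m n = g_{l,m}^n *)
  hd_a : Pfun Q -> laurent;
  hd_hom : Pfun Q -> Pfun Q -> nat;
  hd_fE : forall (F : finFieldType) l m n,
    lau_eval (hd_f l m n) (sqrtC (#|F|%:R : algC))
    = (hall_number (rep_of (hd_M F) l) (rep_of (hd_M F) m)
                   (rep_of (hd_M F) n))%:R;
  hd_gE : forall (F : finFieldType) l m n,
    lau_eval (hd_g l m n) (sqrtC (#|F|%:R : algC))
    = (card_ext (rep_of (hd_M F) l) (rep_of (hd_M F) m)
                (rep_of (hd_M F) n))%:R
      / (card_hom (rep_of (hd_M F) l) (rep_of (hd_M F) m))%:R;
  hd_aE : forall (F : finFieldType) l,
    lau_eval (hd_a l) (sqrtC (#|F|%:R : algC))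
    = (card_aut (rep_of (hd_M F) l))%:R;
  hd_homE : forall (F : finFieldType) l m,
    dim_hom (rep_of (hd_M F) l) (rep_of (hd_M F) m) (hd_hom l m) }.

Section HallPolynomials.
Variables (Q : quiver) (D : hall_data Q).

Definition fv (n l m : Pfun Q) : Qv := lau_eval (hd_f D l m n) v.
Definition gv (n l m : Pfun Q) : Qv := lau_eval (hd_g D l m n) v.
Definition av (l : Pfun Q) : Qv := lau_eval (hd_a D l) v.
Definition av2 (l : Pfun Q) : Qv := lau_eval (hd_a D l) (v ^+ 2).

(* f^l_{l1,l2,l3}, f^l_{l1,l2,l3,l4}, f^l_{l1,l2,l3,l4,l5}; the sums have finite
   support. *)
Definition fv3 (l l1 l2 l3 : Pfun Q) : Qv :=
  \sum_(m \in [set: Pfun Q]%classic) fv l l1 m * fv m l2 l3.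
Definition fv4 (l l1 l2 l3 l4 : Pfun Q) : Qv :=
  \sum_(m \in [set: Pfun Q]%classic) fv l l1 m * fv3 m l2 l3 l4.
Definition fv5 (l l1 l2 l3 l4 l5 : Pfun Q) : Qv :=
  \sum_(m \in [set: Pfun Q]%classic) fv l l1 m * fv4 m l2 l3 l4 l5.

Definition hom_sym (l m : Pfun Q) : nat := (hd_hom D l m + hd_hom D m l)%N.

Definition is_pos_sqrt (p q : laurent) : Prop :=
  lau_eval p v ^+ 2 = lau_eval q v /\ 0 < lau_lead p.

End HallPolynomials.

Section IHall.
Variables (Q : quiver) (rho : quiver_involution Q) (D : hall_data Q).

Definition ihall_coef (l m th nu ga de : Pfun Q) : Qv :=
  v ^ (euler (pf_dim de) (pf_dim th) - euler (pf_dim (pf_act rho de)) (pf_dim th)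
       - euler (pf_dim l) (pf_dim m) + 2 * euler (pf_dim nu) (pf_dim ga))
  * av D de * fv D l de nu * fv D m ga (pf_act rho de) * gv D th nu ga.

Record ihall := IHall {
  ih_alg :> algType Qv;
  ih_K : lattice Q -> ih_alg;
  ih_u : Pfun Q -> ih_alg;
  ih_K0 : ih_K 0 = 1;
  ih_u0 : ih_u (pf_zero Q) = 1;
  ih_KD : forall x y, ih_K x * ih_K y = ih_K (x + y);
  ih_Ku : forall x l, ih_K x * ih_u l =
    v ^ (sym_euler (lat_act rho x) (pf_dim l) - sym_euler x (pf_dim l))
      *: (ih_u l * ih_K x);
  ih_uu : forall l m, ih_u l * ih_u m =
    \sum_(t \in [set: Pfun Q * Pfun Q * Pfun Q * Pfun Q]%classic)
      let '(th, nu, ga, de) := t in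
      ihall_coef l m th nu ga de *: (ih_K (pf_dim de) * ih_u th);
  ih_span : forall x : ih_alg, exists s : seq (Qv * (lattice Q * Pfun Q)),
    x = \sum_(p <- s) p.1 *: (ih_K p.2.1 * ih_u p.2.2);
  ih_free : forall (s : seq (lattice Q * Pfun Q)) (c : lattice Q * Pfun Q -> Qv),
    uniq s -> \sum_(j <- s) c j *: (ih_K j.1 * ih_u j.2) = 0 ->
    {in s, forall j, c j = 0} }.

Variable H : ihall.

Definition ih_basis (j : lattice Q * Pfun Q) : H := ih_K H j.1 * ih_u H j.2.

Definition in_Zform : {pred H} :=
  fun x => `[< exists s : seq (Zv * (lattice Q * Pfun Q)),
    x = \sum_(p <- s) Zv_val p.1 *: ih_basis p.2 >].

Record Zform := ZformElt { Zform_val :> H; _ : Zform_val \in in_Zform }.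

Lemma in_Zform_basis j : ih_basis j \in in_Zform.
Proof. by apply/asboolP; exists [:: (1, j)]; rewrite big_seq1 scale1r. Qed.

Lemma in_ZformD x y : x \in in_Zform -> y \in in_Zform -> x + y \in in_Zform.
Proof.
move=> /asboolP[s ->] /asboolP[t ->]; apply/asboolP; exists (s ++ t).
by rewrite big_cat.
Qed.

Lemma in_ZformZ (c : Qv) x : c \in in_Zv -> x \in in_Zform -> c *: x \in in_Zform.
Proof.
move=> cZ /asboolP[s ->]; apply/asboolP.
exists [seq (ZvElt cZ * p.1, p.2) | p <- s].
by rewrite big_map scaler_sumr; apply: eq_bigr => p _; rewrite scalerA.
Qed.

Lemma in_Zform0 : 0 \in in_Zform.
Proof. by apply/asboolP; exists [::]; rewrite big_nil. Qed.

Lemma in_Zform_sum (I : Type) (s : seq I) (F : I -> H) :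
  (forall i, F i \in in_Zform) -> \sum_(i <- s) F i \in in_Zform.
Proof.
move=> FZ; elim/big_ind: _ => // [|x y]; [exact: in_Zform0|exact: in_ZformD].
Qed.

Lemma in_Zv_exp (n : int) : v ^ n \in in_Zv.
Proof.
have vZ : vh \in in_Zv.
  apply/asboolP; exists (Laurent 0 'X).
  by rewrite /lau_eval map_polyX hornerX divr1.
have vVZ : vh^-1 \in in_Zv.
  apply/asboolP; exists (Laurent 1 1).
  by rewrite /lau_eval rmorph1 hornerC div1r.
by case: n => n; rewrite ?NegzE -?exprnN -?exprnP /v -?exprVn !rpredX.
Qed.

Lemma in_Zv_lau (p : laurent) : lau_eval p v \in in_Zv.
Proof.
rewrite /lau_eval horner_coef mulr_suml rpred_sum // => i _.
rewrite coef_map /= -mulrA rpredM ?rpred_int // rpredM //.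
  exact: (in_Zv_exp (Posz i)).
have := in_Zv_exp (- (Posz (lau_ord p))).
by rewrite -exprnN.
Qed.

Lemma in_Zform_basisM i j : ih_basis i * ih_basis j \in in_Zform.
Proof.
case: i j => [x l] [y m]; rewrite /ih_basis /=.
have uK : ih_u H l * ih_K H y =
    v ^ (- (sym_euler (lat_act rho y) (pf_dim l) - sym_euler y (pf_dim l)))
      *: (ih_K H y * ih_u H l).
  rewrite ih_Ku scalerA -expfzDr ?expf_neq0 ?vh_neq0 // addNr.
  by rewrite expr0z scale1r.
rewrite -mulrA [X in _ * X]mulrA uK -scalerAl -scalerAr.
rewrite in_ZformZ ?in_Zv_exp // -mulrA ih_uu mulrA ih_KD mulr_sumr.
apply: in_Zform_sum => -[[[th nu] ga] de].
rewrite -scalerAr mulrA ih_KD.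
apply: in_ZformZ; last exact: (in_Zform_basis (_, _)).
by do 4![apply: rpredM (in_Zv_lau _)]; exact: in_Zv_exp.
Qed.

Lemma in_Zform_subring_closed : subring_closed in_Zform.
Proof.
have ZN x : x \in in_Zform -> - x \in in_Zform.
  by move=> xZ; rewrite -scaleN1r in_ZformZ // rpredN1.
split=> [|x y xZ yZ|x y].
- have := in_Zform_basis (0, pf_zero Q).
  by rewrite /ih_basis /= ih_K0 ih_u0 mulr1.
- by apply: in_ZformD => //; apply: ZN.
- move=> /asboolP[s ->] /asboolP[t ->].
  rewrite mulr_suml; apply: in_Zform_sum => p.
  rewrite mulr_sumr; apply: in_Zform_sum => p'.
  rewrite -scalerAl -scalerAr scalerA; apply: in_ZformZ (in_Zform_basisM _ _).
  by rewrite rpredM; [|case: p.1|case: p'.1].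
Qed.

HB.instance Definition _ :=
  GRing.isSubringClosed.Build H in_Zform in_Zform_subring_closed.
HB.instance Definition _ := [isSub for Zform_val].
HB.instance Definition _ := [Choice of Zform by <:].
HB.instance Definition _ := [SubChoice_isSubNzRing of Zform by <:].

Lemma Zform_scale_subproof (c : Zv) (x : Zform) :
  Zv_val c *: Zform_val x \in in_Zform.
Proof. by case: c x => c cZ [x xZ]; apply: in_ZformZ. Qed.

Definition Zform_scale (c : Zv) (x : Zform) : Zform :=
  ZformElt (Zform_scale_subproof c x).

Lemma Zform_scaleA c d x :
  Zform_scale c (Zform_scale d x) = Zform_scale (c * d) x.
Proof. by apply: val_inj; rewrite /= scalerA. Qed.

Lemma Zform_scale1 : left_id 1 Zform_scale.
Proof. by move=> x; apply: val_inj; rewrite /= scale1r. Qed.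

Lemma Zform_scaleDr : right_distributive Zform_scale +%R.
Proof. by move=> c x y; apply: val_inj; rewrite /= scalerDr. Qed.

Lemma Zform_scaleDl x : {morph Zform_scale^~ x : c d / c + d}.
Proof. by move=> c d; apply: val_inj; rewrite /= scalerDl. Qed.

HB.instance Definition _ := GRing.Zmodule_isLmodule.Build Zv Zform
  Zform_scaleA Zform_scale1 Zform_scaleDr Zform_scaleDl.

Lemma Zform_scaleAl (c : Zv) (x y : Zform) : c *: (x * y) = c *: x * y.
Proof. by apply: val_inj; rewrite /= scalerAl. Qed.

HB.instance Definition _ := GRing.Lmodule_isLalgebra.Build Zv Zform Zform_scaleAl.

Lemma Zform_scaleAr (c : Zv) (x y : Zform) : c *: (x * y) = x * (c *: y).
Proof. by apply: val_inj; rewrite /= scalerAr. Qed.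

HB.instance Definition _ := GRing.Lalgebra_isAlgebra.Build Zv Zform Zform_scaleAr.

End IHall.

Record tensor_alg (R : comNzRingType) (A B : algType R) := TensorAlg {
  ta_alg :> algType R;
  tens : A -> B -> ta_alg;
  tens_linear_l : forall y, linear (tens^~ y);
  tens_linear_r : forall x, linear (tens x);
  tens_univ : forall (W : lmodType R) (h : A -> B -> W),
    (forall y, linear (h^~ y)) -> (forall x, linear (h x)) ->
    exists2 g : {linear ta_alg -> W},
      forall x y, g (tens x y) = h x y &
      forall g' : {linear ta_alg -> W},
        (forall x y, g' (tens x y) = h x y) -> g' =1 g;
  tens1 : tens 1 1 = 1;
  tensM : forall x x' y y', tens x y * tens x' y' = tens (x * x') (y * y') }.

Section Homomorphisms.
Variables (Q : quiver) (rho : quiver_involution Q).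
Variables (D : hall_data Q) (D' : hall_data (quiver_dbl Q)).
Variables (H : ihall rho D) (H' : ihall (swap Q) D').

Definition fix_sum (x : lattice Q) : int := \sum_(i | rho i == i) x i.

(* The factor vh ^ fix_sum (pf_dim nu) accounts for the half-integral summand
   of Xi. *)
Definition omega_coef (b : Pfun Q -> laurent) (l l1 l2 nu : Pfun Q) : Qv :=
  v ^ (euler (pf_dim l1 - pf_dim (pf_act rho l2)) (pf_dim nu + pf_dim l2)
       + fix_sum (pf_dim l2)
       + 2 * (hom_sym D (pf_f rho nu) (pf_c rho nu))%:Z)
  * vh ^ fix_sum (pf_dim nu)
  * fv3 D l l1 nu l2
  * (av D (pf_double (pf_f rho nu)) / av2 D (pf_f rho nu))
  * lau_eval (b (pf_c rho nu)) v.

Definition is_Omega (b : Pfun Q -> laurent) (Om : {lrmorphism H -> H'}) : Prop :=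
  (forall x : lattice Q, Om (ih_K H x) =
     v ^ fix_sum x *: (ih_K H' (lat_inl (lat_act rho x)) * ih_K H' (lat_inr x)))
  /\
  (forall l : Pfun Q, Om (ih_u H l) =
     \sum_(t \in [set t : Pfun Q * Pfun Q * Pfun Q | in_F rho t.2]%classic)
       let '(l1, l2, nu) := t in
       omega_coef b l l1 l2 nu
         *: (ih_u H' (pf_oplus (pf_act rho l2) l1)
             * ih_K H' (lat_inl (pf_dim nu + pf_dim l2)))).

Definition delta_coef (l l1 l2 l3 nu : Pfun Q) : Qv :=
  let d1 := pf_dim l1 in let d2 := pf_dim l2 in let d3 := pf_dim l3 in
  let dn := pf_dim nu in
  let rd3 := pf_dim (pf_act rho l3) in let rdn := pf_dim (pf_act rho nu) in
  v ^ (euler d1 (d2 + d3) + euler d2 d3 + euler d3 rd3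
       - sym_euler (d2 + d3) rd3 + euler (d1 - d3) (dn + rdn)
       - euler d2 (dn - rdn))
  * fv5 D l l1 nu l2 (pf_act rho nu) l3 * av D nu.

Variable T : tensor_alg H H'.

Definition is_Delta (De : {lrmorphism H -> T}) : Prop :=
  (forall x : lattice Q, De (ih_K H x) =
     tens T (ih_K H x) (ih_K H' (lat_inl (lat_act rho x)) * ih_K H' (lat_inr x)))
  /\
  (forall l : Pfun Q, De (ih_u H l) =
     \sum_(t \in [set: Pfun Q * Pfun Q * Pfun Q * Pfun Q]%classic)
       let '(l1, l2, l3, nu) := t in
       delta_coef l l1 l2 l3 nu
         *: tens T
              (ih_u H l2 * ih_K H (pf_dim (pf_act rho l3) + pf_dim nu))
              (ih_u H' (pf_oplus (pf_act rho l3) l1)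
               * ih_K H' (lat_inl (pf_dim l2 + pf_dim l3 + pf_dim nu
                                   + pf_dim (pf_act rho nu))))).

(* The canonical map from the tensor product of the integral forms over Zv to
   the tensor product over Qv. *)
Definition is_tensor_incl (TZ : tensor_alg (Zform H) (Zform H'))
    (iota : {rmorphism TZ -> T}) : Prop :=
  (forall (c : Zv) (z : TZ), iota (c *: z) = Zv_val c *: iota z) /\
  (forall (x : Zform H) (y : Zform H'),
     iota (tens TZ x y) = tens T (Zform_val x) (Zform_val y)).

End Homomorphisms.

(* Main.v *)
Require Import Defs.
From HB Require Import structures.
From mathcomp Require Import all_boot all_order all_algebra fraction all_field.
From mathcomp Require Import mxrepresentation.
From mathcomp Require Import finmap boolp classical_sets fsbigop.
From mathcomp Require Import cyclic zify ring.

Set Implicit Arguments.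
Unset Strict Implicit.
Unset Printing Implicit Defensive.

Import GRing.Theory Num.Def Num.Theory.
Local Open Scope ring_scope.

(** Both maps are given by explicit formulas on the generators K_alpha and
u_lambda, so each part splits into an integrality statement about coefficients
and some module theory.

The coefficients of the second map, and all but one factor of those of the
first, are built by sums and products from powers of v^(1/2) and from values at
v of Laurent polynomials over the integers.  The exception is the quotient of
a_(2 lambda)(v) by a_lambda(v^2), for lambda = nu_f.  It is integral because
a_lambda has an explicit form: up to a power of v,
  a_lambda(v) = prod_beta prod_(1 <= i <= lambda(beta)) (v^(2i) - 1).
Substituting v^2 for v in a_lambda gives the factors v^(4i) - 1 with
1 <= i <= lambda(beta), which are the factors of even index of a_(2 lambda)(v);
the quotient is the product of the factors of odd index, up to a power of v
([in_Zv_aut_ratio]).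

The form of a_lambda ([aut_polynomial]) is found by counting the automorphisms
of M(lambda) over the prime fields F_p for all large p ([card_aut_rep_of]),
which suffices since a Laurent polynomial is determined by its values at
infinitely many sqrt p.  The count uses that M(lambda) is a sum of pairwise non
isomorphic indecomposables with multiplicities: End M(lambda) maps onto the
product of the matrix algebras of sizes lambda(beta) over F_p, with nilpotent
kernel, so that an endomorphism is invertible exactly when its images are.
Hence |Aut| is to |End| as the product of the orders of the groups
GL(lambda(beta), p) is to the product of the orders of these matrix algebras,
and |End| is the power p^(hom) with an exponent that does not depend on p
([card_aut_mult]).

This requires the endomorphism ring of M(beta) to be local with residue field
F_p ([endo_scalar]).  It is local because some power of any endomorphism is
idempotent, so that an endomorphism of an indecomposable is nilpotent or
invertible.  If its residue field had degree e over F_p, then all entries of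
beta would be multiples of e, and so would be the Euler form <beta, beta>; but
<beta, beta> = 1, because reflections preserve the symmetrized form.  Working
with p larger than all dimensions makes traces available: the residue of an
endomorphism f of M(beta) is the trace of f at a vertex divided by the dimension
there, and an idempotent of trace 0 vanishes.

For the module theory, the tensor product of the integral forms is mapped to the
tensor product of the algebras by its universal property
([tensor_incl_exists]).  This map is injective because the integral forms have
bases that remain linearly independent over Q(v^(1/2)) ([tensor_incl_inj]), and
its image contains the values of the second map on the integral form
([Delta_in_image]); a homomorphism with values in the image of an injective
homomorphism factors through it ([lift_lrmorphism]). *)

(** * Powers, idempotents and nilpotent matrices *)

(** The powers of a matrix over a finite field are eventually periodic.  The
conclusion holds for all multiples of the exponent N, so that finitely many
matrices have a common idempotent power. *)
Lemma mx_exp_idem (F : finFieldType) n (A : 'M[F]_n) :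
  exists2 N, (0 < N)%N &
    forall m, (0 < m)%N -> A ^+ (N * m) * A ^+ (N * m) = A ^+ (N * m).
Proof.
have [a [b [lt_ab eqA]]] : exists a b, (a < b)%N /\ A ^+ a = A ^+ b.
  pose T := #|{: 'M[F]_n}|.
  have /injectivePn[x [y neq_xy eq_xy]] :
      ~~ injectiveb (fun k : 'I_T.+1 => A ^+ k).
    apply/negP => /injectiveP inj; have := leq_card _ inj.
    by rewrite card_ord ltnn.
  have [lt_xy|lt_yx|eq_v] := ltngtP (x : nat) y; first by exists x, y.
    by exists y, x.
  by case/eqP: neq_xy; apply: val_inj.
have per k : A ^+ (a + (b - a) * k) = A ^+ a.
  elim: k => [|k IHk]; first by rewrite muln0 addn0.
  by rewrite mulnS addnA subnKC 1?ltnW // exprD -eqA -exprD.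
(* The exponent must be a multiple of the period b - a and at least a. *)
exists ((b - a) * a.+1)%N => [|m m_gt0].
  by rewrite muln_gt0 subn_gt0 lt_ab.
set N := (_ * m)%N.
have le_aN : (a <= N)%N.
  by rewrite /N -mulnA mulnCA (leq_trans (leqnSn a)) // leq_pmulr // muln_gt0
     subn_gt0 lt_ab.
rewrite -exprD -{1 3}(subnK le_aN) -addnA !exprD; congr (_ * _).
by rewrite -exprD /N -mulnA per.
Qed.

(** The rank factorization splits an idempotent: its image is a direct summand,
included by [row_base] and projected onto by [col_base]. *)
Lemma mul_row_col_base (F : fieldType) n (e : 'M[F]_n) :
  e *m e = e -> row_base e *m col_base e = 1%:M.
Proof.
move=> e_id; apply: (row_full_inj (col_base_full e)).
apply: (row_free_inj (row_base_free e)); rewrite mulmx1 /= mulmx_base mulmxA.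
by rewrite mulmx_base -mulmxA mulmx_base.
Qed.

Lemma mxtrace_idem (F : fieldType) n (e : 'M[F]_n) :
  e *m e = e -> \tr e = (\rank e)%:R.
Proof.
move=> e_id; rewrite -{1}(mulmx_base e) mxtrace_mulC mul_row_col_base //.
by rewrite mxtrace1.
Qed.

(** Frobenius: A commutes with scalars, and c ^+ p = c in the field with p
elements. *)
Lemma mx_exprB_scalar (F : finFieldType) p n (A : 'M[F]_n) (c : F) s :
  prime p -> #|F| = p -> (A - c%:M) ^+ (p ^ s) = A ^+ (p ^ s) - c%:M.
Proof.
move=> p_pr cardF.
case: n A => [|n] A; first by apply/matrixP => -[].
have chF : p \in [pchar F] by apply: (@card_finPcharP F p 1); rewrite ?expn1.
have chM : p \in [pchar 'M[F]_n.+1].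
  have -> : p \in [pchar 'M[F]_n.+1] = ((p%:R : F)%:M == 0 :> 'M_n.+1).
    by rewrite inE p_pr rmorph_nat.
  by rewrite (pcharf0 chF) rmorph0.
elim: s => [|s IHs]; first by rewrite expn0 !expr1.
rewrite expnSr exprM IHs -!(pFrobenius_autE chM).
rewrite GRing.pFrobenius_autB_comm; last exact: comm_mx_scalar.
rewrite !pFrobenius_autE -exprM -expnSr; congr (_ - _).
by rewrite -rmorphXn /= -cardF expf_card.
Qed.

Lemma expr_unitmx (F : fieldType) n (A : 'M[F]_n) N :
  (0 < N)%N -> A ^+ N = 1%:M -> A \in unitmx.
Proof.
case: N => // N _; rewrite exprS => AN.
by have /mulmx1_unit[] : A *m A ^+ N = 1%:M by [].
Qed.

Lemma nilpotent_nunit (F : fieldType) n (A : 'M[F]_n) N :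
  (0 < n)%N -> A ^+ N = 0 -> A \notin unitmx.
Proof.
case: n A => // n A _ AN; apply/negP => uA.
have : A ^+ N \is a GRing.unit by rewrite unitrX.
by rewrite AN unitr0.
Qed.

Lemma mulmx_exprS_swap (F : fieldType) m n (A : 'M[F]_(m, n)) (B : 'M_(n, m))
    k :
  (A *m B) ^+ k.+1 = A *m (B *m A) ^+ k *m B.
Proof.
elim: k => [|k IHk]; first by rewrite expr1 expr0 mulmx1.
rewrite exprS IHk exprS -[LHS]/(_ *m _) -[X in _ = _ *m X *m _]/(_ *m _).
by rewrite !mulmxA.
Qed.

(** Induction on the size: a nilpotent A = C R (rank factorization) is singular,
and R C is a smaller nilpotent matrix with the same trace. *)
Lemma mxtrace_nilpotent (F : fieldType) n (A : 'M[F]_n) N :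
  A ^+ N = 0 -> \tr A = 0.
Proof.
elim/ltn_ind: n A => n IHn A in N * => AN.
have [n0|n_gt0] := posnP n.
  by rewrite /mxtrace big1 // => -[m lt_m]; have := lt_m; rewrite {1}n0.
have lt_r : (\rank A < n)%N.
  rewrite ltn_neqAle rank_leq_row andbT; apply: contraT; rewrite negbK.
  rewrite -[_ == _]/(row_free A) row_free_unit.
  by rewrite (negPf (nilpotent_nunit n_gt0 AN)).
rewrite -(mulmx_base A) mxtrace_mulC; apply: (IHn _ lt_r _ N.+1).
by rewrite mulmx_exprS_swap mulmx_base AN mulmx0 mul0mx.
Qed.

Lemma unitmx_addr_nilpotent (F : fieldType) n (A : 'M[F]_n) N :
  A ^+ N = 0 -> 1%:M + A \in unitmx.
Proof.
move=> AN; case: N AN => [A0|N AN].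
  rewrite (_ : A = 0) ?addr0 ?unitmx1 //.
  by rewrite -(mul1r A) -(expr0 A) A0 mul0r.
have := subrX1 (- A) N.+1.
rewrite exprNn AN mulr0 sub0r => /(congr1 -%R).
rewrite opprK -mulNr opprB opprK.
by case/esym/mulmx1_unit.
Qed.

Lemma natr_neq0_lt_card (F : finFieldType) m : prime #|F| -> (0 < m < #|F|)%N ->
  m%:R != 0 :> F.
Proof.
move=> p_pr /andP[m_gt0 m_lt].
have chF : #|F| \in [pchar F].
  by apply: (@card_finPcharP F #|F| 1); rewrite ?expn1.
by rewrite -(dvdn_pcharf chF) gtnNdvd.
Qed.

(** * Endomorphisms of indecomposable representations *)

Section Morphisms.
Variables (F : finFieldType) (Q : quiver).
Implicit Types X Y Z : rep F Q.

(** Plain dependent functions compose and add without wrappers, unlike the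
finite functions of [lin_family], which are needed only for counting. *)
Definition family_mx X Y : Type :=
  forall i : vertex Q, 'M[F]_(rep_dim X i, rep_dim Y i).

Definition morph X Y (f : family_mx X Y) : Prop :=
  forall a : arrow Q, rep_map X a *m f (tgt a) = f (src a) *m rep_map Y a.

Lemma morphM X Y Z (f : family_mx X Y) (g : family_mx Y Z) :
  morph f -> morph g -> morph (fun i => f i *m g i).
Proof. by move=> mf mg a; rewrite mulmxA mf -mulmxA mg mulmxA. Qed.

Lemma morphB X Y (f g : family_mx X Y) :
  morph f -> morph g -> morph (fun i => f i - g i).
Proof. by move=> mf mg a; rewrite mulmxBr mf mg mulmxBl. Qed.

Lemma morphZ X Y (c : F) (f : family_mx X Y) :
  morph f -> morph (fun i => c *: f i).
Proof. by move=> mf a; rewrite -scalemxAr mf scalemxAl. Qed.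

Lemma morph_sum X Y (I : Type) (r : seq I) (P : pred I)
    (f : I -> family_mx X Y) :
  (forall k, morph (f k)) -> morph (fun i => \sum_(k <- r | P k) f k i).
Proof.
move=> mf a; rewrite mulmx_sumr mulmx_suml.
by apply: eq_bigr => k _; apply: mf.
Qed.

Lemma morph_scalar X (c : F) : morph (fun i => c%:M : 'M_(rep_dim X i)).
Proof. by move=> a; rewrite mul_mx_scalar mul_scalar_mx. Qed.

Lemma morphX X (f : family_mx X X) n : morph f -> morph (fun i => f i ^+ n).
Proof.
move=> mf; elim: n => [|n IHn]; first exact: morph_scalar.
move=> a; have := morphM mf IHn a.
by rewrite !exprS.
Qed.

Definition nilpotent_fam X (f : family_mx X X) : Prop :=
  exists N, forall i, f i ^+ N = 0.

Lemma fam_exp_idem X (f : family_mx X X) :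
  exists2 N, (0 < N)%N & forall i, f i ^+ N *m f i ^+ N = f i ^+ N.
Proof.
have [N N_P] := choice (fun i => let: ex_intro2 N p q := mx_exp_idem (f i) in
  ex_intro (fun N => (0 < N)%N /\ forall m, (0 < m)%N ->
    f i ^+ (N * m) * f i ^+ (N * m) = f i ^+ (N * m)) N (conj p q)).
exists (\prod_i N i)%N; first by rewrite prodn_gt0 // => i; case: (N_P i).
move=> i; have [_] := N_P i; rewrite (bigD1 i) //=; apply.
by rewrite prodn_gt0 // => j; case: (N_P j).
Qed.

(** An idempotent endomorphism e splits X as the sum of the images of e and of
1 - e, so one of the two images is zero. *)
Lemma indec_idem X (e : family_mx X X) : indecomposable X -> morph e ->
  (forall i, e i *m e i = e i) -> (forall i, e i = 0) \/ (forall i, e i = 1%:M).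
Proof.
move=> [_ indX] me e_id.
pose e' : family_mx X X := fun i => 1%:M - e i.
have me' : morph e' by apply: morphB => //; apply: morph_scalar.
have e'_id i : e' i *m e' i = e' i.
  by rewrite mulmxBl mul1mx mulmxBr mulmx1 e_id subrr subr0.
pose im (e : family_mx X X) : rep F Q :=
  @Rep F Q (fun i => \rank (e i)) (fun a =>
    row_base (e (src a)) *m rep_map X a *m col_base (e (tgt a))).
(* The column bases of u form a morphism from X onto the image of u. *)
have im_col (u : family_mx X X) a : morph u -> (forall i, u i *m u i = u i) ->
    rep_map X a *m col_base (u (tgt a)) = col_base (u (src a)) *m
      (row_base (u (src a)) *m rep_map X a *m col_base (u (tgt a))).
  move=> mu u_id; move: (mul_row_col_base (u_id (tgt a))) (mu a).
  move: (mulmx_base (u (src a))) (mulmx_base (u (tgt a))).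
  move: (col_base (u (tgt a))) (row_base (u (tgt a))) => c r.
  move: (col_base (u (src a))) (row_base (u (src a))) => c' r' cr' cr rc ma.
  have uc : u (tgt a) *m c = c.
    by have : c *m r *m c = c; [rewrite -mulmxA rc mulmx1 | rewrite cr].
  by rewrite !mulmxA cr' -ma -[RHS]mulmxA uc.
pose h : lin_family X (rep_sum (im e) (im e')) :=
  [ffun i => row_mx (col_base (e i)) (col_base (e' i))].
have isoh : is_iso h.
  apply/andP; split.
    apply/forallP => a; apply/eqP; rewrite !ffunE /= mul_mx_row mul_row_block.
    rewrite !mulmx0 addr0 add0r; congr row_mx; exact/im_col.
  apply/forallP => i; rewrite ffunE.
  pose g := col_mx (row_base (e i)) (row_base (e' i)).
  have hg : row_mx (col_base (e i)) (col_base (e' i)) *m g = 1%:M.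
    by rewrite mul_row_col !mulmx_base /e' addrC subrK.
  have orth (u w : family_mx X X) : (forall i, u i *m u i = u i) ->
      (forall i, w i *m w i = w i) -> u i *m w i = 0 ->
      row_base (u i) *m col_base (w i) = 0.
    move=> u_id w_id uw0; apply: (row_full_inj (col_base_full (u i))).
    apply: (row_free_inj (row_base_free (w i))) => /=.
    by rewrite mulmxA mulmx_base -mulmxA mulmx_base uw0 mulmx0 mul0mx.
  have gh : g *m row_mx (col_base (e i)) (col_base (e' i)) = 1%:M.
    rewrite mul_col_row !mul_row_col_base // !orth //.
    - by rewrite -scalar_mx_block.
    - by rewrite mulmxBl mul1mx e_id subrr.
    - by rewrite mulmxBr mulmx1 e_id subrr.
  apply/andP; split; first by apply/row_freeP; exists g.
  by apply/row_fullP; exists g.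
have isoX : rep_iso X (rep_sum (im e) (im e')) by apply/existsP; exists h.
have /orP[/forallP z|/forallP z] := indX _ _ isoX.
  by left=> i; apply/eqP; rewrite -mxrank_eq0; apply: z.
by right=> i; apply/esym/eqP; rewrite -subr_eq0 -mxrank_eq0; apply: z.
Qed.

(** Fitting's dichotomy, with invertibility expressed by a power equal to the
identity, which is again a condition on morphisms. *)
Lemma indec_endo X (f : family_mx X X) : indecomposable X -> morph f ->
  nilpotent_fam f \/
  exists2 N, (0 < N)%N & forall i, f i ^+ N = 1%:M.
Proof.
move=> indX mf; have [N N_gt0 f_id] := fam_exp_idem f.
have [z|o] := indec_idem indX (morphX N mf) f_id; first by left; exists N.
by right; exists N.
Qed.

End Morphisms.

(** * The residue field of an indecomposable of root dimension *)

(** The cyclic group generated by g acts freely on nonzero row vectors, so its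
order r divides their number. *)
Lemma dvdn_cyclic_free_action (F : finFieldType) n (g : 'M[F]_n) r :
  (0 < r)%N -> g ^+ r = 1 ->
  (forall (w : 'rV[F]_n) k, w != 0 -> w *m g ^+ k = w -> (r %| k)%N) ->
  (r %| #|F| ^ n - 1)%N.
Proof.
move=> r_gt0 gr free; pose f (w : 'rV[F]_n) := w *m g.
have g_unit : g \in unitmx := expr_unitmx r_gt0 gr.
have f_inj : injective f by apply: can_inj (mulmxK g_unit).
have iterE k w : iter k f w = w *m g ^+ k.
  elim: k => [|k IHk] /=; first by rewrite expr0 mulmx1.
  by rewrite IHk exprSr /f -mulmxA.
have f0 w : (f w == 0) = (w == 0) by rewrite -(inj_eq f_inj w 0) /f mul0mx.
have cardD0 : #|predC1 (0 : 'rV[F]_n)| = (#|F| ^ n - 1)%N.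
  by rewrite cardC1 card_mx mul1n subn1.
rewrite -cardD0 -(@fcard_order_set _ f f_inj r (predC1 0)) ?dvdn_mull //.
- apply/fintype.subsetP => w w0; rewrite !inE eqn_leq; apply/andP; split.
    rewrite leqNgt; apply/negP => lt_r.
    have := findex_iter lt_r; rewrite iterE gr mulmx1.
    have /= -> := @findex_iter _ f w 0 (leq_ltn_trans (leq0n r) lt_r).
    by move=> r0; rewrite -r0 in r_gt0.
  by apply: dvdn_leq (fingraph.order_gt0 _ _) _; apply: (free w) w0 _;
    rewrite -iterE iter_order.
- by move=> w _ /eqP <-; rewrite !inE f0.
Qed.

(** The witness t is the multiplicative order of p modulo r. *)
Lemma dvdn_expn_order r p : coprime p r -> (0 < p)%N -> (0 < r)%N ->
  exists t, forall m, (r %| p ^ m - 1)%N = (t %| m)%N.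
Proof.
move=> co_pr p_gt0 r_gt0.
have dvdE m : (r %| p ^ m - 1)%N = (p ^ m == 1 %[mod r])%N.
  by rewrite eqn_mod_dvd ?expn_gt0 ?p_gt0.
have ext : exists t, (0 < t)%N && (r %| p ^ t - 1)%N.
  exists (totient r); rewrite totient_gt0 r_gt0 dvdE.
  exact/eqP/Euler_exp_totient.
case: (ex_minnP ext) => t /andP[t_gt0]; rewrite dvdE => /eqP pt t_min.
exists t => m; rewrite dvdE.
have -> : p ^ m = p ^ (m %% t) %[mod r].
  rewrite {1}(divn_eq m t) expnD [(m %/ t * t)%N]mulnC expnM.
  by rewrite -modnMml -modnXm pt modnXm exp1n modnMml mul1n.
rewrite -dvdE.
apply/idP/idP => [dvd_r|/eqP->]; last by rewrite expn0 dvdn0.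
rewrite /dvdn -leqn0 leqNgt; apply/negP => mt_gt0.
by have := ltn_pmod m t_gt0; rewrite ltnNge t_min // mt_gt0.
Qed.

Section EulerForm.
Variable Q : quiver.
Implicit Types x y z : lattice Q.

Lemma eulerBl x y z : euler (x - y) z = euler x z - euler y z.
Proof.
have e (I : finType) (f g : I -> vertex Q) :
    \sum_k (x - y) (f k) * z (g k) =
    \sum_k x (f k) * z (g k) - \sum_k y (f k) * z (g k).
  by rewrite -sumrB; apply: eq_bigr => k _; rewrite !ffunE mulrBl.
by rewrite /euler (e _ id id) e; ring.
Qed.

Lemma eulerBr x y z : euler z (x - y) = euler z x - euler z y.
Proof.
have e (I : finType) (f g : I -> vertex Q) :
    \sum_k z (g k) * (x - y) (f k) =
    \sum_k z (g k) * x (f k) - \sum_k z (g k) * y (f k).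
  by rewrite -sumrB; apply: eq_bigr => k _; rewrite !ffunE mulrBr.
by rewrite /euler (e _ id id) e; ring.
Qed.

Lemma euler_mulzl x y n : euler (x *~ n) y = n * euler x y.
Proof.
by rewrite /euler mulrBr !mulr_sumr; congr (_ - _); apply: eq_bigr => k _;
  rewrite ffun_mulzE; ring.
Qed.

Lemma euler_mulzr x y n : euler x (y *~ n) = n * euler x y.
Proof.
by rewrite /euler mulrBr !mulr_sumr; congr (_ - _); apply: eq_bigr => k _;
  rewrite ffun_mulzE; ring.
Qed.

Definition loopless : Prop := forall a : arrow Q, src a != tgt a.

Lemma dynkin_loopless : is_dynkin Q -> loopless.
Proof.
case=> t t_valid [phi [phi' phiK phi'K] edges] a; apply/negP => /eqP loop.
have := edges (phi' (src a)) (phi' (src a)).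
have irr i : dynkin_edge t i i = false.
  apply/negP; case: (t) t_valid => n /=.
  - by move=> _ /eqP; lia.
  - by move=> n_gt3 /orP[/andP[/eqP]|/andP[/eqP + /eqP]]; lia.
  - move=> /andP[n_gt5 _] /orP[/andP[/eqP]|/andP[/eqP + /eqP]];
    lia.
rewrite irr /= /nb_edges phi'K => /eqP; rewrite -leqn0 leqNgt => /negP; apply.
by apply/card_gt0P; exists a; rewrite !inE -loop !eqxx.
Qed.

Lemma euler_simple_root (i : vertex Q) : loopless ->
  euler (simple_root i) (simple_root i) = 1.
Proof.
move=> lQ; rewrite /euler [X in _ - X]big1 ?subr0 => [|a _].
  rewrite (bigD1 i) //= big1 ?addr0 => [|j /negPf ji].
    by rewrite !ffunE eqxx.
  by rewrite !ffunE eq_sym ji.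
rewrite !ffunE; case: eqP => // ->; case: eqP; rewrite ?mulr0 // => e.
by have := lQ a; rewrite e eqxx.
Qed.

(** Since <alpha_i, alpha_i> = 1, the reflection at alpha_i preserves the
quadratic form: the terms linear and quadratic in (x, alpha_i) cancel. *)
Lemma euler_root x : loopless -> is_root x -> euler x x = 1.
Proof.
move=> lQ; elim=> [i|i y _ IHy]; first exact: euler_simple_root.
rewrite /reflection !eulerBl !eulerBr !euler_mulzl !euler_mulzr /sym_euler.
by rewrite IHy euler_simple_root //; ring.
Qed.

End EulerForm.

(** The product of A - c over all elements c of the field is A ^+ q - A = 0. *)
Lemma mx_root_nunit (F : finFieldType) n (A : 'M[F]_n) : (0 < n)%N ->
  A ^+ #|F| = A -> exists c : F, A - c%:M \notin unitmx.
Proof.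
case: n A => // n A _ AF; apply: contrapT => all_unit.
have : \prod_(c : F) (A - c%:M) \is a GRing.unit.
  apply: rpred_prod => c _; apply: contrapT => /negP nunit.
  by case: all_unit; exists c.
rewrite (_ : \prod_c _ = horner_mx A ('X^#|F| - 'X)).
  by rewrite rmorphB rmorphXn /= horner_mx_X AF subrr unitr0.
rewrite finField_genPoly rmorph_prod; apply: eq_bigr => c _.
by rewrite rmorphB /= horner_mx_X horner_mx_C.
Qed.

(** The residue field of the local ring End X is F_p.  An invertible f has
finite order L = p^s r with r prime to p, and g = f^(p^s) has order r.  A power
of g that fixes a nonzero vector differs from 1 by a noninvertible, hence
nilpotent, endomorphism, so by Frobenius its order is a power of p; as this
order also divides r, it is 1.  Hence the group generated by g acts freely on
nonzero vectors, and r divides p^d - 1 for each entry d of the dimension vector.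
So the order t of p modulo r divides all the entries, and then t divides
<dim X, dim X> = 1.  It follows that g^p = g, so that g - c is not invertible
for some c in F_p, hence nilpotent; by Frobenius again, so is f - c. *)
Lemma endo_scalar (F : finFieldType) (Q : quiver) (X : rep F Q)
    (f : family_mx X X) : prime #|F| -> indecomposable X ->
  euler (dimvec X) (dimvec X) = 1 -> morph f ->
  exists c : F, nilpotent_fam (fun i => f i - c%:M).
Proof.
set p := #|F| => p_pr indX eX mf.
have p_gt0 := prime_gt0 p_pr.
have [[N fN]|ordf] := indec_endo indX mf.
  by exists 0, N => i; rewrite raddf0 subr0.
have {ordf} exL : exists L, (0 < L)%N && [forall i, f i ^+ L == 1].
  have [L L0 fL] := ordf; exists L; rewrite L0 /=.
  by apply/forallP => i; rewrite fL.
case: (ex_minnP exL) => L /andP[L_gt0 /forallP fL] L_min.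
have ordL m : (forall i, f i ^+ m = 1) -> (L %| m)%N.
  move=> fm; rewrite /dvdn -leqn0 leqNgt; apply/negP => m_gt0.
  suff /L_min : (0 < m %% L)%N && [forall i, f i ^+ (m %% L) == 1].
    by rewrite leqNgt ltn_pmod.
  rewrite m_gt0 /=; apply/forallP => i; rewrite -(fm i) {2}(divn_eq m L) exprD.
  by rewrite mulnC exprM (eqP (fL i)) expr1n mul1r.
have [r co_pr defL] := pfactor_coprime p_pr L_gt0; set s := logn p L in defL.
have r_gt0 : (0 < r)%N by move: L_gt0; rewrite defL muln_gt0 => /andP[].
pose g : family_mx X X := fun i => f i ^+ (p ^ s).
have gr i : g i ^+ r = 1 by rewrite -exprM mulnC -defL; apply/eqP.
have mg : morph g by apply: morphX.
have ord_g k t : (forall i, g i ^+ (k * p ^ t) = 1) -> (r %| k)%N.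
  move=> gk; suff : (L %| k * p ^ t * p ^ s)%N.
    rewrite defL dvdn_pmul2r ?expn_gt0 ?p_gt0 // Gauss_dvdl //.
    by rewrite coprimeXr // coprime_sym.
  by apply: ordL => i; rewrite mulnC exprM gk.
have dim_dvd i : (r %| p ^ rep_dim X i - 1)%N.
  apply: (dvdn_cyclic_free_action r_gt0 (gr i)) => w k w0 wgk.
  have [[N gN]|[N N_gt0 gN]] := indec_endo indX
    (morphB (morphX k mg) (morph_scalar X 1)).
    apply: (ord_g k N) => j; rewrite exprM; apply/eqP; rewrite -subr_eq0.
    rewrite -[X in _ - X]/(1%:M) -mx_exprB_scalar //; apply/eqP.
    by rewrite -(subnKC (ltnW (ltn_expl N (prime_gt1 p_pr)))) exprD gN mul0r.
  have : w *m (g i ^+ k - 1%:M) = 0 by rewrite mulmxBr wgk mulmx1 subrr.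
  have /mulmxK inj := expr_unitmx N_gt0 (gN i).
  move=> /(congr1 (mulmx^~ (invmx (g i ^+ k - 1%:M)))); rewrite inj mul0mx.
  by move/eqP; rewrite (negPf w0).
have [t tP] := dvdn_expn_order co_pr p_gt0 r_gt0.
have /eqP t1 : t == 1%N.
  have dv i : (t%:Z %| dimvec X i)%Z by rewrite ffunE dvdzE /= -tP dim_dvd.
  have : (1 : int) \in dvdz t.
    by rewrite -eX rpredB // rpred_sum // => k _; rewrite /= dvdz_mulr.
  by rewrite dvdzE dvdn1.
have gp i : g i ^+ p = g i.
  have : (r %| p - 1)%N by rewrite -{1}(expn1 p) tP t1.
  case/dvdnP => q defp; rewrite -(subnK p_gt0) exprD defp mulnC exprM gr.
  by rewrite expr1n mul1r.
have [i Xi] : exists i, (0 < rep_dim X i)%N.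
  case: indX => + _; rewrite negb_forall => /existsP[i Xi]; exists i.
  by rewrite lt0n.
have [c gc] : exists c : F, g i - c%:M \notin unitmx.
  by apply: mx_root_nunit; rewrite ?gp.
have cp : c ^+ (p ^ s) = c.
  by elim: (s) => [|u IHu]; rewrite ?expr1 // expnSr exprM IHu expf_card.
have [[N gN]|[N N_gt0 gN]] := indec_endo indX
    (morphB mg (morph_scalar X c)); last first.
  by case/negP: gc; apply: (expr_unitmx N_gt0 (gN i)).
exists c, (p ^ s * N)%N => j.
by rewrite exprM mx_exprB_scalar // cp.
Qed.

Section ResidueField.
Variables (F : finFieldType) (Q : quiver).

Lemma nilpotent_famMr (X : rep F Q) (f g : family_mx X X) : indecomposable X ->
  morph f -> morph g -> nilpotent_fam f -> nilpotent_fam (fun i => f i *m g i).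
Proof.
move=> indX mf mg [k fk].
have [//|[[//|N] _ fgN]] := indec_endo indX (morphM mf mg).
have [+ _] := indX; rewrite negb_forall => /existsP[i Xi].
have := nilpotent_nunit _ (fk i); rewrite lt0n Xi => /(_ isT)/negP[].
have : f i *m (g i *m (f i *m g i) ^+ N) = 1%:M.
  by rewrite mulmxA -(fgN i) exprS.
by case/mulmx1_unit.
Qed.

(** If f g is not nilpotent then neither is g f, so both are invertible and X, Y
have the same dimensions. *)
Lemma nilpotent_fam_cross (X Y : rep F Q) (f : family_mx X Y)
    (g : family_mx Y X) :
  indecomposable X -> indecomposable Y -> dimvec X != dimvec Y ->
  morph f -> morph g -> nilpotent_fam (fun i => f i *m g i).
Proof.
move=> indX indY neqXY mf mg.
have [//|[[//|N] _ fgN]] := indec_endo indX (morphM mf mg).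
have [[k gfk]|[[//|k] _ gfk]] := indec_endo indY (morphM mg mf).
  by exists k.+1 => i; rewrite mulmx_exprS_swap gfk mulmx0 mul0mx.
case/eqP: neqXY; apply/ffunP => i; rewrite !ffunE; congr Posz; apply/eqP.
have le_dim m n (A : 'M[F]_(m, n)) B : A *m B = 1%:M -> (m <= n)%N.
  move=> AB; rewrite -(mxrank1 F m) -AB.
  by rewrite (leq_trans (mxrankM_maxl _ _)) ?rank_leq_col.
have fg1 : f i *m (g i *m (f i *m g i) ^+ N) = 1%:M.
  by rewrite mulmxA -(fgN i) exprS.
have gf1 : g i *m (f i *m (g i *m f i) ^+ k) = 1%:M.
  by rewrite mulmxA -(gfk i) exprS.
by rewrite eqn_leq (le_dim _ _ _ _ fg1) (le_dim _ _ _ _ gf1).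
Qed.

(** When End X is local with residue field F and the characteristic exceeds the
dimensions, this is the image of f in F.  Taking it as a normalized trace makes
it linear by definition. *)
Definition residue (X : rep F Q) (f : family_mx X X) : F :=
  if [pick i | rep_dim X i != 0%N] is Some i
  then \tr (f i) / (rep_dim X i)%:R else 0.

Lemma residue_sum (X : rep F Q) (I : Type) (r : seq I)
    (f : I -> family_mx X X) :
  residue (fun i => \sum_(k <- r) f k i) = \sum_(k <- r) residue (f k).
Proof.
rewrite /residue; case: pickP => [i _|_]; last by rewrite big1.
by rewrite raddf_sum mulr_suml.
Qed.

Lemma residueZ (X : rep F Q) c (f : family_mx X X) :
  residue (fun i => c *: f i) = c * residue f.
Proof.
rewrite /residue; case: pickP => [i _|_]; last by rewrite mulr0.
by rewrite mxtraceZ mulrA.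
Qed.

Lemma residue_nilpotent (X : rep F Q) (f : family_mx X X) :
  nilpotent_fam f -> residue f = 0.
Proof.
case=> N fN; rewrite /residue; case: pickP => // i _.
by rewrite (mxtrace_nilpotent (fN i)) mul0r.
Qed.

Lemma eq_residue (X : rep F Q) (f g : family_mx X X) :
  (forall i, f i = g i) -> residue f = residue g.
Proof. by move=> fg; rewrite /residue; case: pickP => // i _; rewrite fg. Qed.

Section RootDimension.
Variable X : rep F Q.
Hypothesis (p_pr : prime #|F|) (indX : indecomposable X).
Hypothesis dimX : forall i, (rep_dim X i < #|F|)%N.
Hypothesis eX : euler (dimvec X) (dimvec X) = 1.

Lemma residue_scalar c : residue (fun i => c%:M : 'M_(rep_dim X i)) = c.
Proof.
rewrite /residue; case: pickP => [i Xi|X0].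
  rewrite mxtrace_scalar -[c *+ _]mulr_natr mulfK // natr_neq0_lt_card //.
  by rewrite lt0n Xi dimX.
have [/negP[]] := indX; apply/forallP => i.
by have /negbFE := X0 i.
Qed.

Lemma residueP (f : family_mx X X) : morph f ->
  nilpotent_fam (fun i => f i - (residue f)%:M).
Proof.
move=> mf; have [c nc] := endo_scalar p_pr indX eX mf.
suff -> : residue f = c by [].
rewrite -(residue_scalar c); have := residue_nilpotent nc.
rewrite /residue; case: pickP => // i _; rewrite raddfB mulrBl => /eqP.
by rewrite subr_eq0 => /eqP.
Qed.

Lemma residue0_trace (f : family_mx X X) i :
  morph f -> residue f = 0 -> \tr (f i) = 0.
Proof.
by move=> /residueP + f0; rewrite f0 => -[N fN]; apply: mxtrace_nilpotent (N) _;
  rewrite -(fN i) raddf0 subr0.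
Qed.

(** (f - residue f) g is nilpotent, hence has residue 0. *)
Lemma residueM (f g : family_mx X X) : morph f -> morph g ->
  residue (fun i => f i *m g i) = residue f * residue g.
Proof.
move=> mf mg; have nf := residueP mf.
have mcf := morph_scalar X (residue f).
have /residue_nilpotent := nilpotent_famMr indX (morphB mf mcf) mg nf.
have -> : residue (fun i => (f i - (residue f)%:M) *m g i) =
   residue (fun i => f i *m g i) - residue (fun i => residue f *: g i).
  rewrite /residue; case: pickP => [i _|_]; last by rewrite subrr.
  by rewrite mulmxBl mul_scalar_mx raddfB mulrBl.
by rewrite residueZ => /eqP; rewrite subr_eq0 => /eqP.
Qed.

End RootDimension.
End ResidueField.

(** * Decompositions into isotypic blocks *)

Section Decompositions.
Variables (F : finFieldType) (Q : quiver).

(** X is the direct sum of n k copies of N k, for k in K, given by its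
inclusions and projections.  Indexing the copies of each N k separately keeps
the product of an inclusion and a projection of the same block square, without
casts. *)
Definition decomposes (X : rep F Q) (K : finType) (N : K -> rep F Q)
    (n : K -> nat)
    (inc : forall k, 'I_(n k) -> family_mx (N k) X)
    (pr : forall k, 'I_(n k) -> family_mx X (N k)) : Prop :=
  [/\ forall k j, morph (inc k j), forall k j, morph (pr k j),
      forall k j j' i, inc k j i *m pr k j' i = (j == j')%:R%:M,
      forall k k' j j' i, k != k' -> inc k j i *m pr k' j' i = 0 &
      forall i, \sum_k \sum_j pr k j i *m inc k j i = 1%:M].

Lemma morph_row_mx (X Y Z : rep F Q) (f : family_mx X Y) (g : family_mx X Z) :
  morph f -> morph g ->
  @morph _ _ X (rep_sum Y Z) (fun i => row_mx (f i) (g i)).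
Proof.
move=> mf mg a; rewrite /= mul_mx_row mf mg mul_row_block.
by rewrite !mulmx0 addr0 add0r.
Qed.

Lemma morph_col_mx (X Y Z : rep F Q) (f : family_mx Y X) (g : family_mx Z X) :
  morph f -> morph g ->
  @morph _ _ (rep_sum Y Z) X (fun i => col_mx (f i) (g i)).
Proof.
move=> mf mg a; rewrite /= [RHS]mul_col_mx -mf -mg mul_block_col.
by rewrite !mul0mx addr0 add0r.
Qed.

Lemma morph0 (X Y : rep F Q) : @morph _ _ X Y (fun i => 0).
Proof. by move=> a; rewrite mulmx0 mul0mx. Qed.

Lemma sum_block_mx_dr m n (I : Type) (r : seq I) (f : I -> 'M[F]_n) :
  \sum_(k <- r) block_mx (0 : 'M_m) 0 0 (f k) =
  block_mx 0 0 0 (\sum_(k <- r) f k).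
Proof.
elim/big_rec2: _ => [|k A B _ ->]; first by rewrite block_mx0.
by rewrite add_block_mx !addr0.
Qed.

Lemma iter_rep_sum_decomposes (N : rep F Q) m :
  exists (inc : 'I_m -> family_mx N (iter m (rep_sum N) (rep0 F Q)))
         (pr : 'I_m -> family_mx (iter m (rep_sum N) (rep0 F Q)) N),
  [/\ forall j, morph (inc j), forall j, morph (pr j),
      forall j j' i, inc j i *m pr j' i = (j == j')%:R%:M &
      forall i, \sum_j pr j i *m inc j i = 1%:M].
Proof.
elim: m => [|m [inc [pr [minc mpr orth tot]]]].
  exists (fun _ i => 0), (fun _ i => 0); split=> [j|j|[]|i] //.
  - exact: morph0.
  - exact: morph0.
  - by apply/matrixP => -[].
pose X := iter m (rep_sum N) (rep0 F Q).
pose inc' (k : 'I_m.+1) : family_mx N (rep_sum N X) := fun i =>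
  if unlift ord0 k is Some j then row_mx 0 (inc j i) else row_mx 1%:M 0.
pose pr' (k : 'I_m.+1) : family_mx (rep_sum N X) N := fun i =>
  if unlift ord0 k is Some j then col_mx 0 (pr j i) else col_mx 1%:M 0.
exists inc', pr'; split=> [k|k|k k' i|i].
- rewrite /inc'; case: unlift => [j|].
    by apply: (@morph_row_mx _ N X (fun i => 0)) => //; apply: morph0.
  by apply: (@morph_row_mx _ N X (fun i => 1%:M) (fun i => 0));
    [apply: morph_scalar | apply: morph0].
- rewrite /pr'; case: unlift => [j|].
    by apply: (@morph_col_mx _ N X (fun i => 0)) => //; apply: morph0.
  by apply: (@morph_col_mx _ N X (fun i => 1%:M) (fun i => 0));
    [apply: morph_scalar | apply: morph0].
- have lift0n j : (@ord0 m == lift ord0 j) = false.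
    exact: negPf (neq_lift _ _).
  have lift0n' j : (lift ord0 j == @ord0 m) = false by rewrite eq_sym lift0n.
  rewrite /inc' /pr'.
  case: (unliftP ord0 k) => [j|] ->; case: (unliftP ord0 k') => [j'|] ->;
    rewrite mul_row_col ?mul0mx ?mulmx0 ?mulmx1 ?add0r ?addr0 ?(inj_eq lift_inj)
      ?eqxx ?lift0n ?lift0n' ?raddf0 ?orth //.
- rewrite big_ord_recl /= /inc' /pr' unlift_none.
  under eq_bigr => j _ do rewrite liftK mul_col_row !mul0mx mulmx0.
  rewrite mul_col_row !mulmx0 !mul0mx mulmx1.
  by rewrite sum_block_mx_dr tot add_block_mx !addr0 add0r -scalar_mx_block.
Qed.

(** The inclusions and projections are defined for all b, and vanish for b
outside s. *)
Lemma big_rep_sum_decomposes (I : eqType) (B : I -> rep F Q) (s : seq I) :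
  uniq s ->
  let X := \big[@rep_sum F Q/rep0 F Q]_(b <- s) B b in
  exists (inc : forall b, family_mx (B b) X) (pr : forall b, family_mx X (B b)),
  [/\ forall b, morph (inc b), forall b, morph (pr b),
      forall b i, b \in s -> inc b i *m pr b i = 1%:M,
      forall b b' i, b != b' -> inc b i *m pr b' i = 0 &
      forall i, \sum_(b <- s) pr b i *m inc b i = 1%:M].
Proof.
elim: s => [_|c s IHs /= /andP[sc /IHs/=[inc [pr [minc mpr incpr orth tot]]]]].
  rewrite /= big_nil; exists (fun _ i => 0), (fun _ i => 0).
  split=> // [||b b' i _|i].
  - by move=> ?; apply: morph0.
  - by move=> ?; apply: morph0.
  - by rewrite mulmx0.
  - by apply/matrixP => -[].
rewrite big_cons.
set X := \big[_/_]_(j <- s) _ in inc pr minc mpr incpr orth tot *.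
pose inc' b : family_mx (B b) (rep_sum (B c) X) :=
  if c =P b is ReflectT e
  then ecast b (family_mx (B b) (rep_sum (B c) X)) e
         (fun i => row_mx 1%:M 0)
  else fun i => row_mx 0 (inc b i).
pose pr' b : family_mx (rep_sum (B c) X) (B b) :=
  if c =P b is ReflectT e
  then ecast b (family_mx (rep_sum (B c) X) (B b)) e
         (fun i => col_mx 1%:M 0)
  else fun i => col_mx 0 (pr b i).
have inc'c : inc' c = fun i => row_mx 1%:M 0.
  by rewrite /inc'; case: eqP => // e; rewrite (eq_axiomK e).
have pr'c : pr' c = fun i => col_mx 1%:M 0.
  by rewrite /pr'; case: eqP => // e; rewrite (eq_axiomK e).
have inc'N b : c != b -> inc' b = fun i => row_mx 0 (inc b i).
  by rewrite /inc'; case: eqP.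
have pr'N b : c != b -> pr' b = fun i => col_mx 0 (pr b i).
  by rewrite /pr'; case: eqP.
exists inc', pr'; split=> [b|b|b i|b b' i|i].
- have [<-|cb] := eqVneq c b; last rewrite inc'N //.
    rewrite inc'c; apply: (@morph_row_mx _ _ X (fun i => 1%:M) (fun i => 0)).
      exact: morph_scalar.
    exact: morph0.
  by apply: (@morph_row_mx _ (B c) X (fun i => 0)) => //; apply: morph0.
- have [<-|cb] := eqVneq c b; last rewrite pr'N //.
    rewrite pr'c; apply: (@morph_col_mx _ _ X (fun i => 1%:M) (fun i => 0)).
      exact: morph_scalar.
    exact: morph0.
  by apply: (@morph_col_mx _ (B c) X (fun i => 0)) => //; apply: morph0.
- have [<- _|cb] := eqVneq c b.
    by rewrite inc'c pr'c mul_row_col mulmx1 mulmx0 addr0.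
  rewrite inE eq_sym (negPf cb) /= => sb.
  by rewrite inc'N // pr'N // mul_row_col mul0mx add0r incpr.
- move=> bb'; have [ec|cb] := eqVneq c b.
    move: bb'; case: _ / ec => cb'.
    by rewrite inc'c pr'N // mul_row_col mulmx0 mul0mx addr0.
  rewrite inc'N //; have [<-|cb'] := eqVneq c b'.
    by rewrite pr'c mul_row_col mulmx0 mul0mx addr0.
  by rewrite pr'N // mul_row_col mul0mx add0r orth.
- rewrite big_cons inc'c pr'c big_seq.
  under eq_bigr => b sb.
    have cb : c != b by apply: contraNneq sc => ->.
    rewrite inc'N // pr'N // mul_col_row !mul0mx mulmx0; over.
  rewrite -big_seq mul_col_row !mulmx0 !mul0mx mulmx1.
  by rewrite sum_block_mx_dr tot add_block_mx !addr0 add0r -scalar_mx_block.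
Qed.

Lemma rep_of_decomposes (M : posroot Q -> rep F Q) (l : Pfun Q) :
  exists inc pr,
    @decomposes (rep_of M l) (finsupp l) (fun k => M (val k))
      (fun k => l (val k)) inc pr.
Proof.
pose B b := iter (l b) (rep_sum (M b)) (rep0 F Q).
have [J [P [mJ mP JP orthJ totJ]]] :=
  big_rep_sum_decomposes B (fset_uniq (finsupp l)).
pose I b := cid (iter_rep_sum_decomposes (M b) (l b)).
pose inc b := projT1 (I b).
pose pr b := projT1 (cid (projT2 (I b))).
have IP b : [/\ forall j, morph (inc b j), forall j, morph (pr b j),
      forall j j' i, inc b j i *m pr b j' i = (j == j')%:R%:M &
      forall i, \sum_j pr b j i *m inc b j i = 1%:M].
  exact: (projT2 (cid (projT2 (I b)))).
exists (fun k j i => inc (val k) j i *m J (val k) i).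
exists (fun k j i => P (val k) i *m pr (val k) j i).
split=> [k j|k j|k j j' i|k k' j j' i neq_k|i].
- by case: (IP (val k)) => minc _ _ _; apply: (morphM (minc j) (mJ _)).
- by case: (IP (val k)) => _ mpr _ _; apply: (morphM (mP _) (mpr j)).
- rewrite -mulmxA (mulmxA (J _ i)) JP ?(valP k) // mul1mx.
  by case: (IP (val k)).
- by rewrite -mulmxA (mulmxA (J _ i)) orthJ // mul0mx mulmx0.
- rewrite -(totJ i) big_seq_fsetE; apply: eq_bigr => k _ /=.
  case: (IP (val k)) => _ _ _ tot.
  rewrite -[J _ i in RHS]mul1mx -(tot i) mulmx_suml mulmx_sumr.
  by apply: eq_bigr => j _; rewrite !mulmxA.
Qed.

End Decompositions.

(** * Counting automorphisms *)

Section Multiplicities.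
Variables (F : finFieldType) (Q : quiver) (X : rep F Q) (K : finType).
Variables (N : K -> rep F Q) (n : K -> nat).
Variable inc : forall k, 'I_(n k) -> family_mx (N k) X.
Variable pr : forall k, 'I_(n k) -> family_mx X (N k).
Hypothesis dec : decomposes inc pr.
Hypothesis p_pr : prime #|F|.
Hypothesis indN : forall k, indecomposable (N k).
Hypothesis eN : forall k, euler (dimvec (N k)) (dimvec (N k)) = 1.
Hypothesis dimN : forall k i, (rep_dim (N k) i < #|F|)%N.
Hypothesis dimX : forall i, (rep_dim X i < #|F|)%N.
Hypothesis neqN : forall k k', k != k' -> dimvec (N k) != dimvec (N k').

Definition component k j j' (h : family_mx X X) : family_mx (N k) (N k) :=
  fun i => inc j i *m h i *m pr j' i.

(** The k-th component of the map from End X to the product of the matrix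
algebras of sizes n k. *)
Definition mult_mx k (h : family_mx X X) : 'M[F]_(n k) :=
  \matrix_(j, j') residue (@component k j j' h).

Lemma morph_component k (j j' : 'I_(n k)) h :
  morph h -> morph (component j j' h).
Proof.
by case: dec => minc mpr _ _ _ mh; apply: morphM => //; apply: morphM.
Qed.

Lemma eq_mult_mx k (h h' : family_mx X X) :
  (forall i, h i = h' i) -> mult_mx k h = mult_mx k h'.
Proof.
by move=> hh'; apply/matrixP => j j'; rewrite !mxE; apply: eq_residue => i;
  rewrite /component hh'.
Qed.

(** Insert the decomposition of the identity of X between h and h'.  The terms
that pass through a block k' != k are nilpotent endomorphisms of N k, of residue
0; the others give the entries of the matrix product. *)
Lemma mult_mxM k h h' : morph h -> morph h' ->
  mult_mx k (fun i => h i *m h' i) = mult_mx k h *m mult_mx k h'.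
Proof.
case: dec => minc mpr _ _ tot mh mh'; apply/matrixP => j j'; rewrite !mxE.
pose t k' (m : 'I_(n k')) : family_mx (N k) (N k) :=
  fun i => (inc j i *m h i *m pr m i) *m (inc m i *m h' i *m pr j' i).
transitivity (\sum_k' \sum_m residue (@t k' m)).
  under [RHS]eq_bigr => k' _ do rewrite -residue_sum.
  rewrite -residue_sum; apply: eq_residue => i; rewrite /component.
  rewrite -[h i]mulmx1 -(tot i) mulmx_sumr !mulmx_suml mulmx_sumr mulmx_suml.
  apply: eq_bigr => k' _; rewrite mulmx_sumr !mulmx_suml mulmx_sumr mulmx_suml.
  by apply: eq_bigr => m _; rewrite /t !mulmxA.
rewrite (bigD1 k) //= [X in _ + X]big1 => [|k' kk']; last first.
  rewrite big1 // => m _; apply: residue_nilpotent.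
  apply: nilpotent_fam_cross => //; first by rewrite eq_sym neqN.
    exact: (morphM (morphM (minc _ _) mh) (mpr _ _)).
  exact: (morphM (morphM (minc _ _) mh') (mpr _ _)).
rewrite addr0; apply: eq_bigr => m _; rewrite !mxE.
by apply: residueM => //; apply: morph_component.
Qed.

Lemma mult_mx_scalar k c : mult_mx k (fun i => c%:M) = c%:M.
Proof.
case: dec => _ _ orth _ _; apply/matrixP => j j'; rewrite !mxE.
rewrite -(residue_scalar p_pr (indN k) (dimN k) (c *+ (j == j'))).
apply: eq_residue => i; rewrite /component mul_mx_scalar -scalemxAl orth.
by rewrite scale_scalar_mx mulr_natr.
Qed.

Lemma mult_mxX k h m : morph h ->
  mult_mx k (fun i => h i ^+ m) = mult_mx k h ^+ m.
Proof.
move=> mh; elim: m => [|m IHm]; first exact: mult_mx_scalar.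
rewrite exprS -IHm -[RHS]/(_ *m _) -mult_mxM //; last exact: morphX.
by apply: eq_mult_mx => i; rewrite exprS.
Qed.

Lemma mult_mxB k (h h' : family_mx X X) :
  mult_mx k (fun i => h i - h' i) = mult_mx k h - mult_mx k h'.
Proof.
apply/matrixP => j j'; rewrite !mxE /residue; case: pickP => [i _|_].
  by rewrite /component mulmxBr mulmxBl raddfB mulrBl.
by rewrite subrr.
Qed.

(** A linear section of the family of the maps [mult_mx k]. *)
Definition mult_lift (A : forall k, 'M[F]_(n k)) : family_mx X X := fun i =>
  \sum_k \sum_j \sum_j' A k j j' *: (pr j i *m inc j' i).

Lemma morph_mult_lift A : morph (mult_lift A).
Proof.
case: dec => minc mpr _ _ _.
apply: (@morph_sum _ _ _ _ _ _ _
  (fun k i => \sum_j \sum_j' A k j j' *: (pr j i *m inc j' i))) => k.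
apply: (@morph_sum _ _ _ _ _ _ _
  (fun j i => \sum_j' A k j j' *: (pr j i *m inc j' i))) => j.
apply: (@morph_sum _ _ _ _ _ _ _
  (fun j' i => A k j j' *: (pr j i *m inc j' i))) => j'.
exact: (morphZ (A k j j') (morphM (mpr _ _) (minc _ _))).
Qed.

Lemma mult_liftK A k : mult_mx k (mult_lift A) = A k.
Proof.
case: dec => _ _ orth orth0 _; apply/matrixP => j j'; rewrite !mxE.
rewrite -[RHS](residue_scalar p_pr (indN k) (dimN k)).
apply: eq_residue => i; rewrite /component /mult_lift.
rewrite mulmx_sumr mulmx_suml (bigD1 k) //=.
rewrite [X in _ + X]big1 => [|k' kk']; last first.
  rewrite mulmx_sumr mulmx_suml big1 // => m _.
  rewrite mulmx_sumr mulmx_suml big1 // => m' _.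
  by rewrite -scalemxAr mulmxA orth0 1?eq_sym // mul0mx scaler0 mul0mx.
rewrite addr0 mulmx_sumr mulmx_suml (bigD1 j) //=.
rewrite [X in _ + X]big1 => [|m mj]; last first.
  rewrite mulmx_sumr mulmx_suml big1 // => m' _.
  rewrite -scalemxAr mulmxA orth eq_sym (negPf mj) raddf0.
  by rewrite mul0mx scaler0 mul0mx.
rewrite addr0 mulmx_sumr mulmx_suml (bigD1 j') //=.
rewrite [X in _ + X]big1 => [|m mj]; last first.
  rewrite -scalemxAr -scalemxAl mulmxA -(mulmxA _ (inc m i)) orth (negPf mj).
  by rewrite raddf0 mulmx0 scaler0.
rewrite addr0 -scalemxAr -scalemxAl mulmxA -(mulmxA _ (inc j' i)) !orth !eqxx.
by rewrite mulmx1 scalemx1.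
Qed.

(** An idempotent power e of h is also in the kernel, so the diagonal components
of e have trace 0.  Hence e has trace 0; its rank, being less than p and zero
modulo p, is 0. *)
Lemma mult_mx0_nilpotent h :
  morph h -> (forall k, mult_mx k h = 0) -> nilpotent_fam h.
Proof.
case: dec => minc mpr _ _ tot mh h0; have [[//|m] _ e_id] := fam_exp_idem h.
exists m.+1 => i; apply/eqP; rewrite -mxrank_eq0.
have me : morph (fun i => h i ^+ m.+1) by apply: morphX.
have e0 k : mult_mx k (fun i => h i ^+ m.+1) = 0.
  by rewrite mult_mxX // h0 expr0n.
have : \tr (h i ^+ m.+1) = 0.
  rewrite -[h i ^+ _]mulmx1 -(tot i) mulmx_sumr raddf_sum big1 // => k _.
  rewrite mulmx_sumr raddf_sum big1 // => j _ /=.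
  rewrite mulmxA mxtrace_mulC mulmxA.
  apply: (residue0_trace p_pr (indN k) (dimN k) (eN k)
    (f := component j j (fun i => h i ^+ m.+1)) i).
    exact: morph_component.
  by move/matrixP: (e0 k) => /(_ j j); rewrite !mxE.
rewrite mxtrace_idem // => /eqP; apply: contraTT => rk.
apply: natr_neq0_lt_card => //.
by rewrite lt0n rk (leq_ltn_trans (rank_leq_row _)).
Qed.

(** From right to left, lifting the inverses of the [mult_mx k h] gives g with
h g - 1 in the kernel, hence nilpotent, so that h g is invertible. *)
Lemma unitmx_mult_mx h : morph h ->
  (forall i, h i \in unitmx) <-> (forall k, mult_mx k h \in unitmx).
Proof.
move=> mh; split=> [uh k|uh i].
  have [m m_gt0 h_id] := fam_exp_idem h.
  apply: (expr_unitmx m_gt0); rewrite -mult_mxX // -[RHS](mult_mx_scalar k 1).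
  apply: eq_mult_mx => i; have um : h i ^+ m \in unitmx.
    elim: (m) => [|u IHu]; first by rewrite expr0 unitmx1.
    by rewrite exprS unitmx_mul uh.
  have /(congr1 (mulmx^~ (invmx (h i ^+ m)))) := h_id i.
  by rewrite mulmxK // mulmxV.
pose g := mult_lift (fun k => invmx (mult_mx k h)).
have mg : morph g by apply: morph_mult_lift.
have [m nil] : nilpotent_fam (fun i => h i *m g i - 1%:M).
  apply: mult_mx0_nilpotent.
    exact: (morphB (morphM mh mg) (morph_scalar X 1)).
  move=> k; rewrite mult_mxB mult_mxM // mult_liftK mulmxV //.
  by rewrite mult_mx_scalar subrr.
have := unitmx_addr_nilpotent (nil i).
by rewrite addrC subrK unitmx_mul => /andP[].
Qed.

Notation mults := {dffun forall k : K, 'M[F]_(n k)}.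

Definition in_mult_ker (h : lin_family X X) : bool :=
  is_hom h && [forall k, mult_mx k h == 0%R].

(** All fibres of the map to the product of matrix algebras are translates of
its kernel. *)
Lemma card_morph_mult (P : pred mults) :
  #|[pred h : lin_family X X | is_hom h & P [ffun k => mult_mx k h]]| =
  (#|in_mult_ker| * #|P|)%N.
Proof.
pose phi (h : lin_family X X) : mults := [ffun k => mult_mx k h].
have homP (h : lin_family X X) : reflect (morph h) (is_hom h).
  by apply: (iffP forallP) => hh a; apply/eqP/hh.
rewrite -sum1_card (partition_big phi P) => [|h /andP[]//].
rewrite mulnC -sum_nat_const; apply: eq_bigr => A PA; rewrite sum1_card.
pose s := mult_lift A.
pose tr (h : lin_family X X) : lin_family X X := [ffun i => h i + s i].
have tr_inj : injective tr.
  move=> h h' /ffunP e; apply/ffunP => i; have := e i.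
  by rewrite !ffunE => /addIr.
rewrite -[RHS](card_image tr_inj); apply: eq_card => h.
have mults_s k : mult_mx k s = A k by apply: mult_liftK.
have mapE (h' : lin_family X X) :
    (forall k, mult_mx k h' = 0) -> phi (tr h') = A.
  move=> h'0; apply/ffunP => k; rewrite ffunE; apply/eqP.
  rewrite -mults_s -subr_eq0 -mult_mxB -(h'0 k); apply/eqP/eq_mult_mx => i.
  by rewrite ffunE addrK.
apply/idP/fintype.imageP => [|[h' ]].
  move=> /andP[/andP[/homP mh _] /eqP phi_h].
  exists [ffun i => h i - s i]; last by apply/ffunP => i; rewrite !ffunE subrK.
  apply/andP; split.
    apply/homP => a; rewrite !ffunE.
    exact: (morphB mh (morph_mult_lift A)).
  apply/forallP => k; apply/eqP.
  transitivity (mult_mx k (fun i => h i - s i)).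
    by apply: eq_mult_mx => i; rewrite ffunE.
  by rewrite mult_mxB mults_s -phi_h ffunE subrr.
move=> /andP[/homP mh' /forallP h'0] ->.
have ephi : phi (tr h') = A by apply: mapE => k; apply/eqP.
apply/andP; split; last by rewrite ephi.
apply/andP; split; last by change (P (phi (tr h'))); rewrite ephi.
apply/homP => a; rewrite !ffunE mulmxDr mh' mulmxDl; congr (_ + _).
exact: (morph_mult_lift A a).
Qed.

(** Both |Aut X| and |End X| are counted by [card_morph_mult], and the order of
the kernel cancels. *)
Lemma card_aut_mult :
  (card_aut X * \prod_k #|F| ^ (n k * n k) =
   card_hom X X * \prod_k #|[pred A : 'M[F]_(n k) | A \in unitmx]|)%N.
Proof.
have autE : card_aut X = (#|in_mult_ker|
   * \prod_k #|[pred A : 'M[F]_(n k) | A \in unitmx]|)%N.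
  have -> : (\prod_k #|[pred A : 'M[F]_(n k) | A \in unitmx]|)%N
      = #|[pred A : mults | [forall k, A k \in unitmx]]|.
    pose U k := [pred A : 'M[F]_(n k) | A \in unitmx].
    transitivity #|(family U : simpl_pred mults)|.
      by rewrite card_family foldrE big_map big_enum.
    by apply: eq_card => A; rewrite !inE.
  rewrite -card_morph_mult; apply: eq_card => h; rewrite !inE /is_iso.
  apply: andb_id2l => /forallP hom_h.
  have mh : morph h by move=> a; apply/eqP/hom_h.
  apply/forallP/forallP => [iso k|uh i].
    rewrite ffunE; apply/(unitmx_mult_mx mh).1 => i.
    by have /andP[+ _] := iso i; rewrite row_free_unit.
  rewrite row_free_unit row_full_unit andbb; apply/(unitmx_mult_mx mh).2 => k.
  by have := uh k; rewrite ffunE.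
have homE : card_hom X X = (#|in_mult_ker|
   * \prod_k #|F| ^ (n k * n k))%N.
  have -> : (\prod_k #|F| ^ (n k * n k))%N = #|{: mults}|.
    rewrite card_dep_ffun foldrE big_map big_enum.
    by apply: eq_bigr => k _; rewrite card_mx.
  rewrite -card_morph_mult; apply: eq_card => h; rewrite !inE.
  by rewrite andbT.
by rewrite autE homE mulnAC.
Qed.

End Multiplicities.

(** * The automorphism polynomials *)

Lemma card_unitmx (F : finFieldType) n :
  #|[pred A : 'M[F]_n | A \in unitmx]| =
  (#|F| ^ 'C(n, 2) * \prod_(i < n) (#|F| ^ i.+1 - 1))%N.
Proof.
case: n => [|n].
  rewrite big_ord0 bin0n expn0 muln1 (@eq_card1 _ (0 : 'M_0)) // => A.
  by rewrite !inE flatmx0 unitmxE det_mx00 unitr1 eqxx.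
rewrite -(big_mkord xpredT (fun i => (#|F| ^ i.+1 - 1)%N)).
rewrite -(big_add1 _ _ 0 n.+2 xpredT (fun i => (#|F| ^ i - 1)%N)) -card_GL //.
by rewrite cardsT card_sub; apply: eq_card.
Qed.

Lemma card_hom_dim (F : finFieldType) (Q : quiver) (X Y : rep F Q) d :
  dim_hom X Y d -> card_hom X Y = (#|F| ^ d)%N.
Proof.
case=> e [e_hom e_basis].
pose f (c : 'rV[F]_d) : lin_family X Y := [ffun i => \sum_k c 0 k *: e k i].
have homP (h : lin_family X Y) : reflect (@morph _ _ X Y h) (is_hom h).
  by apply: (iffP forallP) => hh a; apply/eqP/hh.
have f_hom c : is_hom (f c).
  apply/homP => a; rewrite !ffunE.
  apply: (@morph_sum _ _ X Y _ _ _ (fun k i => c 0 k *: e k i)) => k.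
  exact: (morphZ (c 0 k) (elimT (homP _) (e_hom k))).
have f_inj : injective f.
  move=> c c' eq_f; have [c0 [_ uniq_c]] := e_basis (f c) (f_hom c).
  transitivity c0; last by apply: uniq_c => i; rewrite eq_f ffunE.
  by apply/esym/uniq_c => i; rewrite ffunE.
rewrite -[RHS](_ : #|{: 'rV[F]_d}| = _); last by rewrite card_mx mul1n.
rewrite -(card_image f_inj); apply: eq_card => h; rewrite inE.
apply/idP/fintype.imageP => [hh|[c _ ->]] //.
have [c [fc _]] := e_basis h hh; exists c => //.
by apply/ffunP => i; rewrite fc ffunE.
Qed.

Lemma poly_eq_sqrt_prime (P P' : {poly int}) B :
  (forall p, prime p -> (B < p)%N ->
     (map_poly intr P).[sqrtC p%:R] =
     (map_poly intr P').[sqrtC p%:R] :> algC) ->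
  P = P'.
Proof.
move=> eqPP'; apply/eqP; rewrite -subr_eq0; apply/negPn/negP => P0.
pose R := map_poly intr (P - P') : {poly algC}.
have R0 : R != 0.
  by rewrite map_poly_eq0_id0 // intr_eq0 lead_coef_eq0.
have [s [s_uniq s_size s_P]] : exists s : seq nat, [/\ uniq s, size s = size R &
    all (fun p => prime p && (B < p)%N) s].
  elim: (size R) => [|m [s [us ss Ps]]]; first by exists [::].
  have [p lt_p p_pr] := prime_above (maxn B (\max_(q <- s) q)).
  move: lt_p; rewrite gtn_max => /andP[Bp sp].
  exists (p :: s); split=> //=; rewrite ?ss ?p_pr ?Bp ?us ?andbT //.
  apply/negP => ps; move: sp; rewrite ltnNge => /negP; apply.
  exact: (leq_bigmax_seq (F := id) p ps).
have := @max_poly_roots _ R [seq sqrtC p%:R | p <- s] R0.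
rewrite size_map s_size ltnn => contra; suff // : false by [].
apply: contra.
  apply/allP => z /mapP[p /(allP s_P)/andP[p_pr Bp] ->].
  by rewrite /root /R rmorphB hornerD hornerN eqPP' // subrr.
rewrite map_inj_uniq // => p q /(congr1 (fun z => z ^+ 2)).
by rewrite !sqrtCK => /eqP; rewrite eqr_nat => /eqP.
Qed.

Section AutPolynomial.
Variables (Q : quiver) (D : hall_data Q).
Hypothesis lQ : loopless Q.

Lemma rep_dim_rep_of (F : finFieldType) (M : posroot Q -> rep F Q)
    (l : Pfun Q) i :
  rep_dim (rep_of M l) i = (\sum_(b <- finsupp l) l b * rep_dim (M b) i)%N.
Proof.
rewrite /rep_of.
rewrite (big_morph (fun X => rep_dim X i) (id1 := 0%N) (op1 := addn)) //.
apply: eq_bigr => b _; elim: (l b) => [|m IHm] //=.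
by rewrite IHm mulSn.
Qed.

(** The bound makes p exceed the dimensions of M(l), and hence those of the
M(b) with l b > 0. *)
Lemma card_aut_rep_of (p : nat) (l : Pfun Q) : prime p ->
  (forall i, (\sum_(b <- finsupp l) l b * `|root_val b i| < p)%N) ->
  (card_aut (rep_of (hd_M D 'F_p) l) * \prod_(b <- finsupp l) p ^ (l b * l b) =
   p ^ hd_hom D l l * \prod_(b <- finsupp l)
      (p ^ 'C(l b, 2) * \prod_(i < l b) (p ^ i.+1 - 1)))%N.
Proof.
move=> p_pr lt_dim; have cardF : #|'F_p| = p := card_Fp p_pr.
have dimM b i : rep_dim (hd_M D 'F_p b) i = `|root_val b i|%N.
  by rewrite -(hd_M_dim D 'F_p b) ffunE.
have [inc [pr dec]] := rep_of_decomposes (hd_M D 'F_p) l.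
have autE := card_aut_mult dec.
rewrite cardF (card_hom_dim (hd_homE D _ _ _)) cardF in autE.
rewrite !big_seq_fsetE /= autE //.
- by congr muln; apply: eq_bigr => k _; rewrite card_unitmx cardF.
- by move=> k; apply: hd_M_indec.
- move=> k; rewrite hd_M_dim euler_root //.
  by case: (val k) => x /= /andP[/asboolP].
- move=> [b bl] i /=; rewrite dimM; apply: leq_ltn_trans (lt_dim i).
  rewrite (big_fsetD1 b) //= (leq_trans _ (leq_addr _ _)) // leq_pmull //.
  by rewrite lt0n -mem_finsupp.
- by move=> i; rewrite rep_dim_rep_of; under eq_bigr do rewrite dimM.
- move=> k k'; apply: contra_neq; rewrite !hd_M_dim => e.
  by apply: val_inj; apply: val_inj.
Qed.

(** The powers of z stand for an unspecified integer exponent; quantifying over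
all fields allows evaluation both at v and at v^2. *)
Lemma aut_polynomial (l : Pfun Q) : exists S T,
  forall (L : fieldType) (z : L), z != 0 ->
  lau_eval (hd_a D l) z * z ^+ S =
  z ^+ T * \prod_(b <- finsupp l) \prod_(i < l b) (z ^+ (2 * i.+1) - 1).
Proof.
pose S := (\sum_(b <- finsupp l) l b * l b)%N.
pose C := (\sum_(b <- finsupp l) 'C(l b, 2))%N.
pose T := (2 * hd_hom D l l + 2 * C)%N.
pose W (L : pzRingType) (z : L) :=
  \prod_(b <- finsupp l) \prod_(i < l b) (z ^+ (2 * i.+1) - 1).
have W_eval (L : fieldType) (z : L) :
    (map_poly intr (W _ ('X : {poly int}))).[z] = W _ z.
  rewrite /W rmorph_prod horner_prod; apply: eq_bigr => b _.
  rewrite rmorph_prod horner_prod; apply: eq_bigr => i _.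
  by rewrite rmorphB rmorph1 /= map_polyXn hornerD hornerN hornerXn hornerC.
have polyE :
  lau_num (hd_a D l) * 'X^(2 * S) = 'X^(lau_ord (hd_a D l) + T) * W _ 'X.
  pose B := (\max_i (\sum_(b <- finsupp l) l b * `|root_val b i|))%N.
  apply: (@poly_eq_sqrt_prime _ _ B) => p p_pr Bp; set z : algC := sqrtC _.
  have z0 : z != 0 by rewrite sqrtC_eq0 pnatr_eq0 -lt0n prime_gt0.
  have z2 : z ^+ 2 = p%:R by apply: sqrtCK.
  have lt_dim i : (\sum_(b <- finsupp l) l b * `|root_val b i| < p)%N.
    apply: leq_ltn_trans Bp.
    exact: (leq_bigmax
      (F := fun i => \sum_(b <- finsupp l) l b * `|root_val b i|)%N).
  have /(congr1 (fun k => k%:R : algC)) := card_aut_rep_of p_pr lt_dim.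
  rewrite !natrM -(hd_aE D 'F_p) card_Fp // -/z /lau_eval.
  have -> : ((\prod_(b <- finsupp l) p ^ (l b * l b))%N)%:R = z ^+ (2 * S).
    rewrite natr_prod exprM z2 /S expr_sum.
    by apply: eq_bigr => b _; rewrite natrX.
  have -> : ((\prod_(b <- finsupp l) (p ^ 'C(l b, 2) *
      \prod_(i < l b) (p ^ i.+1 - 1)))%N)%:R = z ^+ (2 * C) * W _ z.
    rewrite natr_prod exprM z2 /C expr_sum -big_split /=.
    apply: eq_bigr => b _; rewrite natrM natrX; congr (_ * _).
    rewrite natr_prod; apply: eq_bigr => i _.
    by rewrite natrB ?expn_gt0 ?prime_gt0 // natrX exprM z2.
  rewrite natrX -z2 -exprM mulrA -exprD -/T mulrAC => e.
  rewrite !rmorphM /= !map_polyXn !hornerM !hornerXn W_eval exprD -mulrA -e.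
  by rewrite mulrC [RHS]mulrC divfK ?expf_neq0 // mulrC.
exists (2 * S)%N, T => L z z0.
have /(congr1 (fun P => (map_poly intr P).[z] : L)) := polyE.
rewrite !rmorphM /= !map_polyXn !hornerM !hornerXn W_eval exprD => e.
by rewrite /lau_eval mulrAC e mulrC -[X in _ * X]mulrA mulKf ?expf_neq0.
Qed.

End AutPolynomial.

(** * Integrality of the coefficients *)

Lemma laurent_ratio (L : fieldType) (z a1 a2 P O : L) (S1 T1 S2 T2 : nat) :
  z != 0 -> a2 != 0 ->
  a1 * z ^+ S1 = z ^+ T1 * (P * O) ->
  a2 * (z ^+ 2) ^+ S2 = (z ^+ 2) ^+ T2 * P ->
  a1 / a2 = z ^ (T1%:Z - S1%:Z) * z ^ ((2 * S2)%:Z - (2 * T2)%:Z) * O.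
Proof.
move=> z0 a2_neq0 e1 e2; rewrite -!exprM in e2.
have zn k : z ^+ k != 0 by apply: expf_neq0.
have P_neq0 : P != 0.
  apply: contraNneq a2_neq0 => P0.
  by rewrite -(mulIr_eq0 _ (mulIf (zn (2 * S2)%N))) e2 P0 mulr0.
have -> : a1 = z ^+ T1 * (P * O) / z ^+ S1 by rewrite -e1 mulfK.
have -> : a2 = z ^+ (2 * T2) * P / z ^+ (2 * S2) by rewrite -e2 mulfK.
rewrite !expfzDr // -!exprnN -!exprnP.
by field; rewrite !zn P_neq0.
Qed.

Section Integrality.
Variables (Q : quiver) (D : hall_data Q).
Hypothesis lQ : loopless Q.

Lemma prod_ord_double (R : comPzRingType) (f : nat -> R) n :
  \prod_(i < n.*2) f i = (\prod_(i < n) f (i.*2.+1)) * \prod_(i < n) f i.*2.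
Proof.
elim: n => [|n IHn]; first by rewrite !big_ord0 mulr1.
by rewrite doubleS !big_ord_recr /= IHn; ring.
Qed.

Lemma pf_doubleE (l : Pfun Q) b : pf_double l b = (l b).*2.
Proof. by rewrite fsfunE; case: finsuppP. Qed.

Lemma finsupp_double (l : Pfun Q) : finsupp (pf_double l) = finsupp l.
Proof. by apply/fsetP => b; rewrite !mem_finsupp pf_doubleE double_eq0. Qed.

Lemma in_Zv_exprn n : v ^+ n \in in_Zv.
Proof. exact: (in_Zv_exp (Posz n)). Qed.

(** In a_(2 lambda)(v), the factors v^(2i) - 1 with i even are those of
a_lambda(v^2); O is the product of the others. *)
Lemma in_Zv_aut_ratio (l : Pfun Q) : av D (pf_double l) / av2 D l \in in_Zv.
Proof.
have v0 : v != 0 by rewrite expf_neq0 ?vh_neq0.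
have [S1 [T1 e1]] := aut_polynomial D lQ (pf_double l).
have [S2 [T2 e2]] := aut_polynomial D lQ l.
have {}e1 := e1 _ v v0; have {}e2 := e2 _ (v ^+ 2) (expf_neq0 2 v0).
rewrite -/(av D _) finsupp_double in e1; rewrite -/(av2 D _) in e2.
pose O := \prod_(b <- finsupp l) \prod_(i < l b) (v ^+ (2 * i.*2.+1) - 1).
have O_Z : O \in in_Zv.
  by apply: rpred_prod => b _; apply: rpred_prod => i _;
     rewrite rpredB ?rpred1 ?in_Zv_exprn.
have PO :
   \prod_(b <- finsupp l) \prod_(i < pf_double l b) (v ^+ (2 * i.+1) - 1) =
   (\prod_(b <- finsupp l) \prod_(i < l b) ((v ^+ 2) ^+ (2 * i.+1) - 1)) * O.
  rewrite -big_split /=; apply: eq_bigr => b _.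
  rewrite pf_doubleE (prod_ord_double (fun i => v ^+ (2 * i.+1) - 1)).
  congr (_ * _); apply: eq_bigr => i _; rewrite -exprM; congr (_ ^+ _ - _).
  by rewrite -doubleS -mul2n mulnA.
rewrite PO in e1.
move: e2 e1; set P := \prod_(b <- _) _; move: (av _ _) (av2 _ _) => a1 a2 e2 e1.
(* If a2 = 0, the quotient is 0 by the convention on division by 0. *)
have [->|a2_neq0] := eqVneq a2 0; first by rewrite invr0 mulr0 rpred0.
rewrite (laurent_ratio v0 a2_neq0 e1 e2) rpredM // rpredM //; exact: in_Zv_exp.
Qed.

End Integrality.

Lemma in_Zv_fv (Q : quiver) (D : hall_data Q) n l m : fv D n l m \in in_Zv.
Proof. exact: in_Zv_lau. Qed.

Section Coefficients.
Variables (Q : quiver) (rho : quiver_involution Q) (D : hall_data Q).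

Lemma in_Zv_vh_exp (n : int) : vh ^ n \in in_Zv.
Proof.
have vZ : vh \in in_Zv.
  apply/asboolP; exists (Laurent 0 'X).
  by rewrite /lau_eval map_polyX hornerX divr1.
have vVZ : vh^-1 \in in_Zv.
  apply/asboolP; exists (Laurent 1 1).
  by rewrite /lau_eval rmorph1 hornerC div1r.
by case: n => n; rewrite ?NegzE -?exprnN -?exprnP -?exprVn rpredX.
Qed.

(** The sum over all m is by definition a sum over an enumeration of its
support. *)
Lemma in_Zv_fv3 l l1 l2 l3 : fv3 D l l1 l2 l3 \in in_Zv.
Proof. by apply: rpred_sum => m _; apply: rpredM; apply: in_Zv_fv. Qed.

Lemma in_Zv_fv4 l l1 l2 l3 l4 : fv4 D l l1 l2 l3 l4 \in in_Zv.
Proof.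
by apply: rpred_sum => m _; apply: rpredM; [apply: in_Zv_fv|apply: in_Zv_fv3].
Qed.

Lemma in_Zv_fv5 l l1 l2 l3 l4 l5 : fv5 D l l1 l2 l3 l4 l5 \in in_Zv.
Proof.
by apply: rpred_sum => m _; apply: rpredM; [apply: in_Zv_fv|apply: in_Zv_fv4].
Qed.

Lemma in_Zv_omega (b : Pfun Q -> laurent) l l1 l2 nu : loopless Q ->
  omega_coef rho D b l l1 l2 nu \in in_Zv.
Proof.
move=> lQ; apply: rpredM (in_Zv_lau _); apply: rpredM (in_Zv_aut_ratio _ lQ _).
apply: rpredM (in_Zv_fv3 _ _ _ _); apply: rpredM (in_Zv_vh_exp _).
exact: in_Zv_exp.
Qed.

Lemma in_Zv_delta l l1 l2 l3 nu : delta_coef rho D l l1 l2 l3 nu \in in_Zv.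
Proof.
apply: rpredM (in_Zv_lau _); apply: rpredM (in_Zv_fv5 _ _ _ _ _ _).
exact: in_Zv_exp.
Qed.

Variable H : ihall rho D.

Lemma in_Zform_K x : ih_K H x \in in_Zform (H := H).
Proof.
by have := in_Zform_basis H (x, pf_zero Q); rewrite /ih_basis /= ih_u0 mulr1.
Qed.

Lemma in_Zform_u l : ih_u H l \in in_Zform (H := H).
Proof.
by have := in_Zform_basis H (0, l); rewrite /ih_basis /= ih_K0 mul1r.
Qed.

End Coefficients.

Lemma in_Zform_Omega (Q : quiver) (rho : quiver_involution Q)
    (D : hall_data Q) (D' : hall_data (quiver_dbl Q)) (b : Pfun Q -> laurent)
    (H : ihall rho D) (H' : ihall (swap Q) D') (Om : {lrmorphism H -> H'}) :
  loopless Q -> is_Omega b Om ->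
  forall x, x \in in_Zform (H := H) -> Om x \in in_Zform (H := H').
Proof.
move=> lQ [OmK Omu] x /asboolP[s ->].
rewrite raddf_sum; apply: in_Zform_sum => p.
rewrite /= linearZ /=; apply: in_ZformZ; first by case: (p.1).
rewrite rmorphM /= OmK Omu; apply: rpredM.
  apply: in_ZformZ; first exact: in_Zv_exp.
  by apply: rpredM; apply: in_Zform_K.
apply: in_Zform_sum => -[[l1 l2] nu].
apply: in_ZformZ; first exact: in_Zv_omega.
by apply: rpredM; [apply: in_Zform_u | apply: in_Zform_K].
Qed.

(** * Factoring homomorphisms through the integral forms *)

(** A homomorphism with values in the image of an injective one factors through
it.  C need not be an algebra over the small ring: its scalar action is given by
the function act. *)
Lemma lift_lrmorphism (A B : algType Zv) (C : nzRingType) (act : Zv -> C -> C)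
    (f : A -> C) (iota : {rmorphism B -> C}) :
  injective iota ->
  (forall c y, iota (c *: y) = act c (iota y)) ->
  (forall x y, f (x - y) = f x - f y) -> f 1 = 1 -> {morph f : x y / x * y} ->
  (forall c x, f (c *: x) = act c (f x)) ->
  (forall x, exists y, iota y = f x) ->
  exists g : {lrmorphism A -> B}, forall x, iota (g x) = f x.
Proof.
move=> iota_inj iotaZ fB f1 fM fZ im.
pose g x := projT1 (cid (im x)).
have gE x : iota (g x) = f x := projT2 (cid (im x)).
have gB : zmod_morphism g.
  by move=> x y; apply: iota_inj; rewrite rmorphB !gE fB.
have gM : monoid_morphism g.
  by split=> [|x y]; apply: iota_inj; rewrite ?rmorph1 ?rmorphM !gE.
have gZ : scalable g by move=> c x; apply: iota_inj; rewrite iotaZ !gE fZ.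
pose G : {lrmorphism A -> B} := HB.pack g
  (GRing.isZmodMorphism.Build _ _ g gB)
  (GRing.isMonoidMorphism.Build _ _ g gM)
  (GRing.isScalable.Build _ _ _ _ g gZ).
by exists G.
Qed.

(** * Bases and coordinates *)

Lemma sum_collect (R : pzRingType) (V : lmodType R) (J : eqType) (E : J -> V)
    (s : seq (R * J)) :
  \sum_(p <- s) p.1 *: E p.2 =
  \sum_(j <- undup [seq p.2 | p <- s]) (\sum_(p <- s | p.2 == j) p.1) *: E j.
Proof.
under [RHS]eq_bigr => j _ do rewrite scaler_suml.
rewrite (exchange_big_dep xpredT) //= big_seq [RHS]big_seq.
apply: eq_bigr => p sp.
rewrite big_mkcond (bigD1_seq p.2) ?undup_uniq //=; last first.
  by rewrite mem_undup map_f.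
by rewrite eqxx big1 ?addr0 // => j /negPf; rewrite eq_sym => ->.
Qed.

Section Coordinates.
Variables (Q : quiver) (rho : quiver_involution Q) (D : hall_data Q).
Variable H : ihall rho D.
Notation index := (lattice Q * Pfun Q)%type.

Lemma basis_sum_inj (s t : seq (Qv * index)) :
  \sum_(p <- s) p.1 *: ih_basis H p.2 = \sum_(p <- t) p.1 *: ih_basis H p.2 ->
  forall j, \sum_(p <- s | p.2 == j) p.1 = \sum_(p <- t | p.2 == j) p.1.
Proof.
move=> /eqP; rewrite -subr_eq0 => /eqP st j.
pose r := s ++ [seq (- p.1, p.2) | p <- t].
have r_sum (P : pred index) : \sum_(p <- r | P p.2) p.1 =
    \sum_(p <- s | P p.2) p.1 - \sum_(p <- t | P p.2) p.1.
  by rewrite big_cat big_map /= sumrN.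
have r0 : \sum_(p <- r) p.1 *: ih_basis H p.2 = 0.
  rewrite big_cat big_map /= -[RHS]st; congr (_ + _).
  by rewrite -sumrN; apply: eq_bigr => p _; rewrite scaleNr.
apply/eqP; rewrite -subr_eq0 -(r_sum (pred1 j)) /=; apply/eqP.
have [rj|rj] := boolP (j \in undup [seq p.2 | p <- r]).
  apply: (ih_free (i := H) (undup_uniq [seq p.2 | p <- r])
    (c := fun j => \sum_(p <- r | p.2 == j) p.1) _ rj).
  by rewrite -sum_collect.
rewrite big_seq_cond big1 // => p /andP[rp /eqP pj].
by case/negP: rj; rewrite mem_undup -pj map_f.
Qed.

(** Coordinates in the expression of x chosen by [cid]; they are those of any
expression of x in the basis. *)
Definition ih_coord (j : index) (x : H) : Qv :=
  \sum_(p <- projT1 (cid (ih_span x)) | p.2 == j) p.1.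

Lemma ih_coordE j x (s : seq (Qv * index)) :
  x = \sum_(p <- s) p.1 *: ih_basis H p.2 ->
  ih_coord j x = \sum_(p <- s | p.2 == j) p.1.
Proof.
move=> xs; apply: basis_sum_inj; rewrite -xs.
exact/esym/(projT2 (cid (ih_span x))).
Qed.

Lemma ih_coord_linear j a x y :
  ih_coord j (a *: x + y) = a * ih_coord j x + ih_coord j y.
Proof.
have [[s xs] [t yt]] := (ih_span x, ih_span y).
rewrite (ih_coordE j xs) (ih_coordE j yt).
rewrite (@ih_coordE _ _ ([seq (a * p.1, p.2) | p <- s] ++ t)).
  by rewrite big_cat big_map /= mulr_sumr.
rewrite big_cat big_map /= {1}xs {1}yt scaler_sumr; congr (_ + _).
by apply: eq_bigr => p _; rewrite scalerA.
Qed.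

Lemma ih_coord_basis j k : ih_coord j (ih_basis H k) = (k == j)%:R.
Proof.
rewrite (@ih_coordE _ _ [:: (1, k)]) ?big_seq1 ?scale1r //.
by rewrite big_cons big_nil /=; case: eqP; rewrite ?addr0.
Qed.

End Coordinates.

(** * Tensor products of the integral forms *)

Section TensorSpan.
Variables (R : comNzRingType) (A B : algType R) (T : tensor_alg A B).

Definition in_tensor_span : {pred T} := fun z =>
  `[< exists s : seq (A * B), z = \sum_(p <- s) tens T p.1 p.2 >].

Lemma tensZl a x y : tens T (a *: x) y = a *: tens T x y.
Proof.
have := tens_linear_l T y a x 0; rewrite addr0 => ->.
have := tens_linear_l T y (-1) x x.
rewrite scaleN1r addNr => ->; rewrite scaleN1r addNr addr0; by [].
Qed.

Lemma tensZr a x y : tens T x (a *: y) = a *: tens T x y.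
Proof.
have := tens_linear_r T x a y 0; rewrite addr0 => ->.
have := tens_linear_r T x (-1) y y.
rewrite scaleN1r addNr => ->; rewrite scaleN1r addNr addr0; by [].
Qed.

Lemma in_tensor_span_closed : submod_closed in_tensor_span.
Proof.
split=> [|a z z' /asboolP[s ->] /asboolP[t ->]]; apply/asboolP.
  by exists [::]; rewrite big_nil.
exists ([seq (a *: p.1, p.2) | p <- s] ++ t).
rewrite big_cat big_map scaler_sumr.
by congr (_ + _); apply: eq_bigr => p _; rewrite tensZl.
Qed.

HB.instance Definition _ :=
  GRing.isSubmodClosed.Build R T in_tensor_span in_tensor_span_closed.

Record tensor_span := TensorSpan {
  tensor_span_val :> T; _ : tensor_span_val \in in_tensor_span }.

HB.instance Definition _ := [isSub for tensor_span_val].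
HB.instance Definition _ := [Choice of tensor_span by <:].
HB.instance Definition _ := [SubChoice_isSubLmodule of tensor_span by <:].

Lemma in_tensor_span_tens x y : tens T x y \in in_tensor_span.
Proof. by apply/asboolP; exists [:: (x, y)]; rewrite big_seq1. Qed.

(** The universal property maps T to the span of the pure tensors; followed by
the inclusion, this agrees with the identity on pure tensors, so by uniqueness
it is the identity. *)
Lemma tensor_spanP (z : T) :
  exists s : seq (A * B), z = \sum_(p <- s) tens T p.1 p.2.
Proof.
have [||g gE _] := tens_univ T
  (h := fun x y => TensorSpan (in_tensor_span_tens x y)).
- by move=> y a x x'; apply: val_inj; rewrite /= tens_linear_l.
- by move=> x a y y'; apply: val_inj; rewrite /= tens_linear_r.
have [g0 _ uniq_g] := tens_univ T (tens_linear_l T) (tens_linear_r T).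
suff zE : z = val (g z).
  by have /asboolP[s sE] := valP (g z); exists s; rewrite -sE.
pose vg : {linear T -> T} := (val \o g : T -> T).
rewrite -[RHS]/(vg z) -[LHS]/(idfun z) (uniq_g idfun) // (uniq_g vg) // => x y.
by rewrite /= gE.
Qed.

End TensorSpan.

(** Restriction of scalars from Q(v^(1/2)) to the integral Laurent polynomials
in v^(1/2), a target for linear maps over the small ring. *)
Definition Zv_restriction (V : lmodType Qv) : Type := V.

Section ScalarRestriction.
Variable V : lmodType Qv.

HB.instance Definition _ := GRing.Zmodule.on (Zv_restriction V).

Let scale (c : Zv) (x : Zv_restriction V) : Zv_restriction V :=
  Zv_val c *: (x : V).

Fact Zv_restriction_scaleA c d x : scale c (scale d x) = scale (c * d) x.
Proof. by rewrite /scale scalerA. Qed.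

Fact Zv_restriction_scale1 : left_id 1 scale.
Proof. by move=> x; rewrite /scale scale1r. Qed.

Fact Zv_restriction_scaleDr : right_distributive scale +%R.
Proof. by move=> c x y; rewrite /scale scalerDr. Qed.

Fact Zv_restriction_scaleDl x : {morph scale^~ x : c d / c + d}.
Proof. by move=> c d; rewrite /scale scalerDl. Qed.

HB.instance Definition _ := GRing.Zmodule_isLmodule.Build Zv (Zv_restriction V)
  Zv_restriction_scaleA Zv_restriction_scale1
  Zv_restriction_scaleDr Zv_restriction_scaleDl.

End ScalarRestriction.

Section ZformBasis.
Variables (Q : quiver) (rho : quiver_involution Q) (D : hall_data Q).
Variable H : ihall rho D.

Definition Zform_basis (j : lattice Q * Pfun Q) : Zform H :=
  ZformElt (in_Zform_basis H j).

Lemma Zform_sum_basis (x : Zform H) :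
  exists s : seq (Zv * (lattice Q * Pfun Q)),
  x = \sum_(p <- s) p.1 *: Zform_basis p.2.
Proof.
have /asboolP[s xs] := valP x; exists s; apply: val_inj.
by rewrite raddf_sum /=.
Qed.

End ZformBasis.

Section TensorInclusion.
Variables (Q : quiver) (rho : quiver_involution Q).
Variables (D : hall_data Q) (D' : hall_data (quiver_dbl Q)).
Variables (H : ihall rho D) (H' : ihall (swap Q) D').
Variables (T : tensor_alg H H') (TZ : tensor_alg (Zform H) (Zform H')).

(** The universal property yields a linear map; it is multiplicative since pure
tensors span. *)
Lemma tensor_incl_exists :
  exists iota : {rmorphism TZ -> T}, is_tensor_incl iota.
Proof.
pose h (x : Zform H) (y : Zform H') : Zv_restriction T :=
  tens T (Zform_val x) (Zform_val y).
have [y c x x'|x c y y'|g gE _] := tens_univ TZ (h := h).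
- exact: (tens_linear_l T (Zform_val y) (Zv_val c)).
- exact: (tens_linear_r T (Zform_val x) (Zv_val c)).
pose f (z : TZ) : T := g z.
have f_tens x y : f (tens TZ x y) = tens T (Zform_val x) (Zform_val y).
  exact: gE.
have fB : zmod_morphism f by move=> x y; apply: (raddfB g).
have f_sum (I : Type) (s : seq I) (F : I -> TZ) :
    f (\sum_(i <- s) F i) = \sum_(i <- s) f (F i).
  exact: (raddf_sum g).
have fM : monoid_morphism f.
  split=> [|z z']; first by rewrite -(tens1 TZ) f_tens tens1.
  have [[s ->] [t ->]] := (tensor_spanP z, tensor_spanP z').
  rewrite mulr_suml !f_sum mulr_suml; apply: eq_bigr => p _.
  rewrite mulr_sumr !f_sum mulr_sumr; apply: eq_bigr => p' _.
  by rewrite tensM !f_tens tensM.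
pose iota : {rmorphism TZ -> T} := HB.pack f
  (GRing.isZmodMorphism.Build _ _ f fB) (GRing.isMonoidMorphism.Build _ _ f fM).
by exists iota; split=> // c z; apply: (linearZ_LR g).
Qed.

Lemma tensor_sum_basis (z : TZ) : exists s : seq (Zv * ((lattice Q * Pfun Q) *
    (lattice (quiver_dbl Q) * Pfun (quiver_dbl Q)))),
  z = \sum_(p <- s) p.1 *: tens TZ (Zform_basis H p.2.1) (Zform_basis H' p.2.2).
Proof.
have [s ->] := tensor_spanP z.
elim: s => [|[x y] s [t IHs]]; first by exists [::]; rewrite !big_nil.
rewrite big_cons {}IHs /=.
have [[a ->] [b ->]] := (Zform_sum_basis x, Zform_sum_basis y).
exists ([seq (p.1 * q.1, (p.2, q.2)) | p <- a, q <- b] ++ t).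
rewrite big_cat big_allpairs_dep; congr (_ + _).
pose Fl y0 : {linear Zform H -> TZ} := HB.pack (tens TZ ^~ y0)
  (GRing.isLinear.Build _ _ _ _ (tens TZ ^~ y0) (tens_linear_l TZ y0)).
pose Fr x0 : {linear Zform H' -> TZ} := HB.pack (tens TZ x0)
  (GRing.isLinear.Build _ _ _ _ (tens TZ x0) (tens_linear_r TZ x0)).
rewrite -[LHS]/(Fl _ _) raddf_sum; apply: eq_bigr => p _.
rewrite -[LHS]/(Fr _ _) raddf_sum; apply: eq_bigr => q _ /=.
by rewrite tensZl tensZr scalerA.
Qed.

(** Write z in terms of the tensors of basis elements.  The products of a
coordinate function on H and one on H' extend to T, and applied to the image of
z they recover each coefficient of z. *)
Lemma tensor_incl_inj (iota : {rmorphism TZ -> T}) :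
  is_tensor_incl iota -> injective iota.
Proof.
case=> iotaZ iota_tens; suff inj0 z : iota z = 0 -> z = 0.
  move=> z z' /eqP; rewrite -subr_eq0 -rmorphB => /eqP/inj0/eqP.
  by rewrite subr_eq0 => /eqP.
have [s zE] := tensor_sum_basis z.
pose E i := tens TZ (Zform_basis H i.1) (Zform_basis H' i.2).
have {zE} -> := etrans zE (sum_collect E s).
rewrite rmorph_sum /=; set r := undup _ => iz0.
suff coef0 (j : lattice Q * Pfun Q)
    (k : lattice (quiver_dbl Q) * Pfun (quiver_dbl Q)) :
    (j, k) \in r -> \sum_(p <- s | p.2 == (j, k)) p.1 = 0.
  by rewrite big_seq big1 // => -[j k] r_jk; rewrite coef0 // scale0r.
move=> r_jk.
pose h (x : H) (y : H') : Qv^o := ih_coord j x * ih_coord k y.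
have [y c x x'|x c y y'|g gE _] := tens_univ T (h := h).
- by rewrite /h ih_coord_linear mulrDl -mulrA.
- by rewrite /h ih_coord_linear mulrDr mulrCA.
have hE a c : h (Zform_val (Zform_basis H a)) (Zform_val (Zform_basis H' c)) =
    (a == j)%:R * (c == k)%:R by rewrite /h !ih_coord_basis.
have := congr1 g iz0; rewrite raddf0 raddf_sum /=.
under eq_bigr => i _.
  rewrite iotaZ iota_tens linearZ /= gE hE; over.
rewrite (bigD1_seq (j, k)) ?undup_uniq //= !eqxx.
rewrite [X in _ + X]big1 => [|[j' k'] neq_jk].
  rewrite addr0 mulr1 => e; apply: val_inj.
  exact: etrans (esym (mulr1 _)) e.
move: neq_jk; rewrite xpair_eqE negb_and.
by case/orP => /negPf ->; rewrite ?mul0r ?mulr0 scaler0.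
Qed.

Lemma Delta_in_image (iota : {rmorphism TZ -> T}) (De : {lrmorphism H -> T}) :
  is_tensor_incl iota -> is_Delta De ->
  forall x : Zform H, exists y, iota y = De (Zform_val x).
Proof.
case=> iotaZ iota_tens [DeK Deu] x.
pose im (t : T) := exists y, iota y = t.
have im0 : im 0 by exists 0; rewrite rmorph0.
have imD t t' : im t -> im t' -> im (t + t').
  by move=> [y <-] [y' <-]; exists (y + y'); rewrite rmorphD.
have imM t t' : im t -> im t' -> im (t * t').
  by move=> [y <-] [y' <-]; exists (y * y'); rewrite rmorphM.
have imZ (c : Qv) t : c \in in_Zv -> im t -> im (c *: t).
  by move=> cZ [y <-]; exists (ZvElt cZ *: y); rewrite iotaZ.
have im_tens x1 x2 : x1 \in in_Zform (H := H) -> x2 \in in_Zform (H := H') ->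
    im (tens T x1 x2).
  move=> x1Z x2Z; exists (tens TZ (ZformElt x1Z) (ZformElt x2Z)).
  by rewrite iota_tens.
have im_sum (I : Type) (s : seq I) (F : I -> T) : (forall i, im (F i)) ->
    im (\sum_(i <- s) F i).
  by move=> imF; elim/big_ind: _.
have /asboolP[s ->] := valP x.
rewrite raddf_sum; apply: (im_sum) => p; rewrite /= linearZ /=.
apply: (imZ); first by case: (p.1).
rewrite rmorphM /= DeK Deu; apply: (imM).
  apply: (im_tens); first exact: in_Zform_K.
  by apply: rpredM; apply: in_Zform_K.
apply: (im_sum) => -[[[l1 l2] l3] nu].
apply: (imZ); first exact: in_Zv_delta.
by apply: (im_tens); apply: rpredM; by [apply: in_Zform_u | apply: in_Zform_K].
Qed.

End TensorInclusion.

Theorem proposition5p2 (Q : quiver) (hQ : is_dynkin Q) (rho : quiver_involution Q)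
    (D : hall_data Q) (D' : hall_data (quiver_dbl Q))
    (b : Pfun Q -> laurent)
    (hb : forall l : Pfun Q, in_F rho l ->
            is_pos_sqrt (b (pf_c rho l)) (hd_a D (pf_c rho l)))
    (H : ihall rho D) (H' : ihall (swap Q) D')
    (T : tensor_alg H H') (TZ : tensor_alg (Zform H) (Zform H')) :
  (forall Om : {lrmorphism H -> H'}, is_Omega b Om ->
     exists OmZ : {lrmorphism Zform H -> Zform H'},
       forall x : Zform H, Zform_val (OmZ x) = Om (Zform_val x))
  /\
  (forall De : {lrmorphism H -> T}, is_Delta De ->
     exists iota : {rmorphism TZ -> T},
       [/\ is_tensor_incl iota, injective iota &
         exists DeZ : {lrmorphism Zform H -> TZ},
           forall x : Zform H, iota (DeZ x) = De (Zform_val x)]).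
Proof.
have lQ := dynkin_loopless hQ; split=> [Om isOm|De isDe].
  pose iota : {rmorphism Zform H' -> H'} := val.
  apply: (@lift_lrmorphism _ _ _ (fun c y => Zv_val c *: y)
    (fun x : Zform H => Om (Zform_val x)) iota) => //.
  - exact: val_inj.
  - by move=> x y; rewrite /= rmorphB.
  - by rewrite /= rmorph1.
  - by move=> x y; rewrite /= rmorphM.
  - by move=> c x; rewrite /= linearZ.
  - move=> x; have OmxZ := in_Zform_Omega lQ isOm (valP x).
    by exists (ZformElt OmxZ).
have [iota incl] := tensor_incl_exists T TZ.
have iota_inj := tensor_incl_inj incl.
exists iota; split=> //.
apply: (@lift_lrmorphism _ _ _ (fun c y => Zv_val c *: y)
  (fun x : Zform H => De (Zform_val x)) iota) => //.
- by case: incl.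
- by move=> x y; rewrite /= rmorphB.
- by rewrite /= rmorph1.
- by move=> x y; rewrite /= rmorphM.
- by move=> c x; rewrite /= linearZ.
- exact: Delta_in_image incl isDe.
Qed.
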